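(* Let $F$ be a compact metric space and $m$ a finite Radon measure on $F$. Suppose that $(\mathcal{A},\mathcal{F})$ and $(\mathcal{B},\mathcal{F})$ are local, regular, conservative, irreducible Dirichlet forms on $L^2(F,m)$ with the same domain $\mathcal{F}$, and that $\mathcal{A}(u,u)\le\mathcal{B}(u,u)$ for all $u\in\mathcal{F}$. Let $\delta>0$ and $\mathcal{E}=(1+\delta)\mathcal{B}-\mathcal{A}$. Then $(\mathcal{E},\mathcal{F})$ is a regular, local, conservative, irreducible Dirichlet form on $L^2(F,m)$. *)

(* Defs.v *)
From HB Require Import structures.
From mathcomp Require Import all_boot all_order all_algebra.
From mathcomp Require Import all_classical all_reals all_analysis.

Set Implicit Arguments.
Unset Strict Implicit.
Unset Printing Implicit Defensive.
Import Order.TTheory GRing.Theory Num.Theory.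
Import numFieldNormedType.Exports.
Local Open Scope classical_set_scope.
Local Open Scope ring_scope.

Definition Borel (T : ptopologicalType) := g_sigma_algebraType (@open T).

Section DirichletForms.
Variables (R : realType) (F : pseudoPMetricType R).
Variable m : {measure set (Borel F) -> \bar R}.

Definition L2 (f : F -> R) : Prop :=
  measurable_fun [set: Borel F] (f : Borel F -> R) /\
  (\int[m]_x ((f x) ^+ 2)%:E < +oo)%E.

Definition aeq (f g : F -> R) : Prop :=
  ae_eq m [set: Borel F] (f : Borel F -> R) (g : Borel F -> R).

Definition ip (f g : F -> R) : R := fine (\int[m]_x (f x * g x)%:E).
Definition nrm2 (f : F -> R) : R := ip f f.

(** A form (E, D): D is a set of (representatives of) L^2 functions, E a
    real-valued function of two arguments; only its values on D matter. *)
Section Form.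
Variables (D : set (F -> R)) (E : (F -> R) -> (F -> R) -> R).

Definition E1 (u : F -> R) : R := E u u + nrm2 u.

Definition symmetric_form : Prop :=
  [/\ (forall u, D u -> L2 u),
      (forall u v, D u -> L2 v -> aeq u v -> D v),
      (forall u u' v v', D u -> D u' -> D v -> D v' -> aeq u u' -> aeq v v' ->
          E u v = E u' v'),
      [/\ D (fun _ => 0),
          (forall u v, D u -> D v -> D (fun x => u x + v x)) &
          (forall (c : R) u, D u -> D (fun x => c * u x))] &
      (forall f, L2 f -> forall eps : R, 0 < eps ->
          exists u, D u /\ nrm2 (fun x => f x - u x) < eps)] /\
  [/\ (forall u v, D u -> D v -> E u v = E v u),
      (forall (c : R) u v w, D u -> D v -> D w ->
          E (fun x => c * u x + v x) w = c * E u w + E v w) &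
      (forall u, D u -> 0 <= E u u)].

Definition closed_form : Prop :=
  forall u : nat -> F -> R, (forall n, D (u n)) ->
  (forall eps : R, 0 < eps -> exists N, forall n k, (N <= n)%N -> (N <= k)%N ->
      E1 (fun x => u n x - u k x) < eps) ->
  exists w, D w /\ (forall eps : R, 0 < eps -> exists N, forall n, (N <= n)%N ->
      E1 (fun x => u n x - w x) < eps).

Definition markovian : Prop :=
  forall u, D u ->
    D (fun x => Num.min (Num.max 0 (u x)) 1) /\
    E (fun x => Num.min (Num.max 0 (u x)) 1) (fun x => Num.min (Num.max 0 (u x)) 1)
      <= E u u.

Definition dirichlet_form : Prop := [/\ symmetric_form, closed_form & markovian].

(** Regularity (F is compact, so C_c(F) = C(F)): D \cap C(F) is dense in D for
    the E_1-norm and dense in C(F) for the uniform norm. *)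
Definition regular : Prop :=
  (forall u, D u -> forall eps : R, 0 < eps ->
      exists v : F -> R, [/\ D v, continuous v & E1 (fun x => u x - v x) < eps]) /\
  (forall g : F -> R, continuous g -> forall eps : R, 0 < eps ->
      exists v : F -> R, [/\ D v, continuous v & forall x, `|v x - g x| < eps]).

(** Support of u: the support of the measure u(x) m(dx). *)
Definition supp (u : F -> R) : set F :=
  [set x | forall U : set F, open U -> U x ->
     (0 < m (U `&` [set y | u y != 0%R]))%E].

Definition local_form : Prop :=
  forall u v, D u -> D v -> compact (supp u) -> compact (supp v) ->
    supp u `&` supp v = set0 -> E u v = 0.

(** The semigroup: t |-> T_t f is the (unique) L^2-continuous solution on
    [0, oo) of the weak heat equation
      d/dt (u(t), v) = - E(u(t), v)  (v in D, t > 0),  u(t) in D (t > 0),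
    with initial value u(0) = f. *)
Definition heat_solution (f : F -> R) (u : R -> F -> R) : Prop :=
  [/\ aeq (u 0) f,
      (forall t : R, 0 <= t -> L2 (u t)),
      (forall t : R, 0 <= t -> forall eps : R, 0 < eps -> exists eta : R, 0 < eta /\
          forall s, 0 <= s -> `|s - t| < eta -> nrm2 (fun x => u s x - u t x) < eps),
      (forall t : R, 0 < t -> D (u t)) &
      (forall v, D v -> forall t : R, 0 < t ->
          is_derive t (1 : R) (fun s : R => ip (u s) v) (- E (u t) v))].

Definition conservative : Prop :=
  forall u, heat_solution (fun _ => 1) u -> forall t : R, 0 < t -> aeq (u t) (fun _ => 1).

Definition invariant_set (A : set F) : Prop :=
  measurable (A : set (Borel F)) /\
  forall f, L2 f -> forall u w,
    heat_solution (fun x => \1_A x * f x) u -> heat_solution f w ->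
    forall t : R, 0 < t -> aeq (u t) (fun x => \1_A x * w t x).

Definition irreducible : Prop :=
  forall A : set F, invariant_set A ->
    m (A : set (Borel F)) = 0%E \/ m (~` A : set (Borel F)) = 0%E.

End Form.
End DirichletForms.

(* Main.v *)
(* By regularity and the Markov property the constant 1 lies in the domain, and
   conservativeness gives A(1, .) = B(1, .) = 0: the heat flow of 1 exists and
   is constant.  Hence E(1, .) = 0 as well, and E is closed and local because
   delta B <= E <= (1 + delta) B.

   Markov property: for continuous f, let f' = (0 v f) ^ 1.  Then
   f - f' = (f - 1)^+ - (-f)^+, and locality together with E(1, .) = 0 gives
   E(f', f - f') = 0, so E(f, f) = E(f', f') + E(f - f', f - f').  The general
   case follows by approximation and lower semicontinuity.

   Irreducibility: if S is E-invariant, the heat flow of its indicator is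
   constant, so E(1_S, .) = 0 and therefore B(1_S, 1_S) = 0.  Multiplication by
   1_S then does not increase B, hence S is B-invariant.

   The heat flow exists for every initial value in L^2: with T = (1 + A)^-1,
   0 <= T <= 1, it is phi_t(T) for phi_t(x) = exp(- t (1/x - 1)), and the
   functional calculus of T is the limit of Bernstein polynomials in T, which
   are positive operators when their coefficients are nonnegative. *)
Require Import Defs.
From HB Require Import structures.
From mathcomp Require Import all_boot all_order all_algebra.
From mathcomp Require Import all_classical all_reals all_analysis.
From mathcomp Require Import measurable_realfun lebesgue_integrable.
From mathcomp Require Import ring lra.
Import Order.TTheory GRing.Theory Num.Theory.
Import numFieldNormedType.Exports.
Local Open Scope classical_set_scope.
Local Open Scope ring_scope.

Set Implicit Arguments.
Unset Strict Implicit.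
Unset Printing Implicit Defensive.

(** * Positive semidefinite forms *)

Section BilinearForms.
Variables (R : realType) (V : lmodType R).
Implicit Types B : V -> V -> R.

(** Conservativeness and invariance are stated for all heat solutions. As hypotheses they say
    nothing until a solution is known to exist; as conclusions they require uniqueness. Existence
    thus turns conservativeness of [EA] and [EB], and invariance for [E], into identities between
    forms; uniqueness leads from such identities back to conservativeness of [E] and to invariance
    for [EB].

    The Markov property is the delicate one, as differences of Markovian forms need not inherit it.
    Comparison with [EB] controls the energy of a truncation only up to the factor
    [(1 + delta) / delta]; locality removes this factor.

    Elements of [D] and of L^2 are functions and not classes, so the forms are only semidefinite and
    Riesz representatives are determined only up to null vectors. *)

Definition sym_bilinear B : Prop :=
  (forall u v, B u v = B v u) /\
  (forall a u v w, B (a *: u + v) w = a * B u w + B v w).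

Definition psd_form B : Prop := sym_bilinear B /\ forall u, 0 <= B u u.

Section SymBilinear.
Variables (B : V -> V -> R) (bB : sym_bilinear B).

Lemma formC u v : B u v = B v u. Proof. exact: bB.1. Qed.

Lemma formDl u v w : B (u + v) w = B u w + B v w.
Proof. by have := bB.2 1 u v w; rewrite scale1r mul1r. Qed.

Lemma form0l w : B 0 w = 0.
Proof. by have := formDl 0 0 w; rewrite addr0; lra. Qed.

Lemma formZl a u w : B (a *: u) w = a * B u w.
Proof. by have := bB.2 a u 0 w; rewrite addr0 form0l addr0. Qed.

Lemma formNl u w : B (- u) w = - B u w.
Proof. by rewrite -scaleN1r formZl mulN1r. Qed.

Lemma formBl u v w : B (u - v) w = B u w - B v w.
Proof. by rewrite formDl formNl. Qed.

Lemma formDr u v w : B w (u + v) = B w u + B w v.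
Proof. by rewrite formC formDl !(formC w). Qed.

Lemma form0r w : B w 0 = 0. Proof. by rewrite formC form0l. Qed.

Lemma formZr a u w : B w (a *: u) = a * B w u.
Proof. by rewrite formC formZl formC. Qed.

Lemma formNr u w : B w (- u) = - B w u.
Proof. by rewrite formC formNl formC. Qed.

Lemma formBr u v w : B w (u - v) = B w u - B w v.
Proof. by rewrite formDr formNr. Qed.

Definition formE := (formDl, formDr, formNl, formNr, formZl, formZr, form0l, form0r).

End SymBilinear.

Section PsdForm.
Variables (B : V -> V -> R) (pB : psd_form B).
Let bB := pB.1.

Lemma psd_ge0 u : 0 <= B u u. Proof. exact: pB.2. Qed.

Lemma cauchy_schwarz u v : (B u v) ^+ 2 <= B u u * B v v.
Proof.
have h a : 0 <= B u u + 2 * a * B u v + a ^+ 2 * B v v.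
  by have := psd_ge0 (u + a *: v); rewrite !(formE bB) (formC bB v u); lra.
have := psd_ge0 v; rewrite le_eqVlt => /predU1P[v0|v0].
  rewrite -v0 mulr0; have /eqP -> : B u v == 0; last by rewrite expr0n.
  apply/negPn/negP => uv0.
  (* When [B v v = 0] the bound [h] is affine in [a]; this [a] gives it the value -1. *)
  have := h (- (B u u + 1) / (2 * B u v)); rewrite -v0 mulr0 addr0.
  have -> : 2 * (- (B u u + 1) / (2 * B u v)) * B u v = - (B u u + 1) by field.
  by lra.
have := h (- B u v / B v v).
have -> : B u u + 2 * (- B u v / B v v) * B u v + (- B u v / B v v) ^+ 2 * B v v
   = (B u u * B v v - B u v ^+ 2) / B v v by field; rewrite gt_eqF.
by rewrite pmulr_lge0 ?invr_gt0// subr_ge0.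
Qed.

Lemma psd_null_l u v : B u u = 0 -> B u v = 0.
Proof.
move=> u0; have := cauchy_schwarz u v; rewrite u0 mul0r => h.
by apply/eqP; rewrite -sqrf_eq0 eq_le h sqr_ge0.
Qed.

Lemma psd_null_r u v : B v v = 0 -> B u v = 0.
Proof. by move=> v0; rewrite (formC bB) psd_null_l. Qed.

Lemma psdD_le2 u v : B (u + v) (u + v) <= 2 * B u u + 2 * B v v.
Proof.
have := psd_ge0 (u - v); rewrite !(formE bB) (formC bB v u); lra.
Qed.

Lemma psdBC u v : B (u - v) (u - v) = B (v - u) (v - u).
Proof. by rewrite !(formE bB) (formC bB v u); ring. Qed.

Lemma psd_midpoint u v :
  B (u - v) (u - v) = 2 * B u u + 2 * B v v
    - 4 * B (2^-1 *: (u + v)) (2^-1 *: (u + v)).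
Proof. by rewrite !(formE bB) (formC bB v u); field. Qed.

Lemma psd_midpoint_le u v c : B u u <= c -> B v v <= c ->
  B (2^-1 *: (u + v)) (2^-1 *: (u + v)) <= c.
Proof.
move=> uc vc; have := psd_midpoint u v; have := psd_ge0 (u - v); lra.
Qed.

Lemma psd_norm_le u v : `|B u v| <= Num.sqrt (B u u) * Num.sqrt (B v v).
Proof.
rewrite -sqrtrM ?psd_ge0// -sqrtr_sqr ler_sqrt ?cauchy_schwarz//.
by rewrite mulr_ge0 ?psd_ge0.
Qed.

Lemma psd_sqrt_triangle u v :
  Num.sqrt (B (u + v) (u + v)) <= Num.sqrt (B u u) + Num.sqrt (B v v).
Proof.
have su := sqrtr_ge0 (B u u); have sv := sqrtr_ge0 (B v v).
rewrite -(ler_pXn2r (_ : 0 < 2)%N) ?nnegrE ?sqrtr_ge0 ?addr_ge0//.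
rewrite sqr_sqrtr ?psd_ge0// sqrrD !sqr_sqrtr ?psd_ge0//.
suff : B u v <= Num.sqrt (B u u) * Num.sqrt (B v v).
  by rewrite !(formE bB) (formC bB v u); lra.
exact: le_trans (ler_norm _) (psd_norm_le _ _).
Qed.

Lemma psd_sqr_sqrt u : B u u = Num.sqrt (B u u) * Num.sqrt (B u u).
Proof. by rewrite -expr2 sqr_sqrtr ?psd_ge0. Qed.

Lemma psd_sqrt_le u c : 0 <= c -> B u u <= c * Num.sqrt (B u u) -> Num.sqrt (B u u) <= c.
Proof.
have e := psd_sqr_sqrt u; move=> c0; rewrite {1}e.
have := sqrtr_ge0 (B u u); rewrite le_eqVlt => /predU1P[<-//|u0].
by rewrite ler_pM2r.
Qed.

Lemma psd_limit_le l c :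
  (forall eps : R, 0 < eps -> exists w, B (w - l) (w - l) < eps /\ B w w <= c) ->
  B l l <= c.
Proof.
move=> h; have c0 : 0 <= c.
  by have [w [_]] := h 1 ltr01; apply: le_trans; exact: psd_ge0.
rewrite -(ler_sqrt _ c0); apply/ler_addgt0Pr => eps e0.
have [w [wl wc]] := h (eps ^+ 2) (exprn_gt0 _ e0).
have := psd_sqrt_triangle w (l - w); rewrite addrC subrK psdBC => /le_trans; apply.
rewrite lerD ?ler_sqrt// -(ger0_norm (ltW e0)) -sqrtr_sqr ler_sqrt ?sqr_ge0//.
exact: ltW.
Qed.

End PsdForm.

(** Completeness for a seminorm: the limit [w] is determined only up to null vectors of [B]. *)
Definition form_complete B : Prop := forall u : nat -> V,
  (forall eps : R, 0 < eps -> exists N, forall n k, (N <= n)%N -> (N <= k)%N ->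
     B (u n - u k) (u n - u k) < eps) ->
  exists w, forall eps : R, 0 < eps -> exists N, forall n, (N <= n)%N ->
     B (u n - w) (u n - w) < eps.

Section NestedMinimisers.
Variables (B : V -> V -> R) (pB : psd_form B) (cB : form_complete B).
Variables (K : nat -> set V) (C : R).
Hypothesis K_decr : forall n k v, (n <= k)%N -> K k v -> K n v.
Hypothesis K_mid : forall n u v, K n u -> K n v -> K n (2^-1 *: (u + v)).
Hypothesis K_bounded : forall n, exists v, K n v /\ B v v <= C.

(* The minimal energies over the shrinking convex sets increase to a limit, so
   by the parallelogram law almost minimisers form a Cauchy sequence. *)
Lemma nested_minimisers : exists (w : nat -> V) (l : V),
  [/\ (forall n, K n (w n)),
      (forall eps : R, 0 < eps -> exists N, forall n, (N <= n)%N ->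
         B (w n - l) (w n - l) < eps) &
      (forall v, (forall n, K n v) -> B l l <= B v v)].
Proof.
pose S n := [set B v v | v in K n].
have S_lb n : lbound (S n) 0 by move=> _ [v _ <-]; exact: psd_ge0.
have S_inf n : has_inf (S n).
  split; last by exists 0; exact: S_lb.
  by have [v [Kv _]] := K_bounded n; exists (B v v), v.
pose d n := inf (S n).
have d_le n v : K n v -> d n <= B v v.
  by move=> Kv; apply: (ge_inf (proj2 (S_inf n))); exists v.
have d_mono n k : (n <= k)%N -> d n <= d k.
  move=> nk; apply: lb_le_inf; first exact: (proj1 (S_inf k)).
  by move=> _ [v Kv <-]; apply: d_le; exact: K_decr Kv.
have dC n : d n <= C.
  by have [v [Kv vC]] := K_bounded n; exact: le_trans (d_le _ _ Kv) vC.
have /choice[w hw] : forall n, exists v, K n v /\ B v v < d n + n.+1%:R^-1.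
  move=> n; have p : 0 < (n.+1%:R : R)^-1 by rewrite invr_gt0 ltr0n.
  by have [_ [v Kv <-] lt] := inf_adherent p (S_inf n); exists v.
have d_sup : has_sup (range d).
  by split; [exists (d 0%N), 0%N | exists C => _ [n _ <-]; exact: dC].
have w_cauchy (eps : R) : 0 < eps -> exists N, forall n k, (N <= n)%N -> (N <= k)%N ->
    B (w n - w k) (w n - w k) < eps.
  (* The energies are within [eps / 8] of [d n] and [d k], and the midpoint lies in [K n], so the
     parallelogram law bounds the distance by [2 * (d k - d n) + eps / 2]; beyond [N1] one has
     [d k - d n < eps / 8]. *)
  move=> e0; have e8 : 0 < eps / 8 by lra.
  have [_ [N1 _ <-] N1P] := sup_adherent e8 d_sup.
  have [N2 N2P] : exists N, (N.+1%:R : R)^-1 < eps / 8.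
    have [N _ /(_ N (leqnn _)) h] := near_infty_natSinv_lt (PosNum e8).
    by exists N.
  exists (maxn N1 N2) => n k nN kN.
  wlog nk : n k nN kN / (n <= k)%N => [th|].
    case/orP: (leq_total n k) => h; first exact: th.
    by rewrite (psdBC pB); exact: th.
  have [Kn wn] := hw n; have [Kk wk] := hw k.
  have inv_le i : (N2 <= i)%N -> (i.+1%:R : R)^-1 <= N2.+1%:R^-1.
    by move=> h; rewrite lef_pV2 ?posrE ?ltr0n// ler_nat.
  have nN2 : (N2 <= n)%N by rewrite (leq_trans _ nN)// leq_maxr.
  have kN2 : (N2 <= k)%N by rewrite (leq_trans _ kN)// leq_maxr.
  have in1 := inv_le n nN2; have ik1 := inv_le k kN2.
  have dk_sup : d k <= sup (range d) by apply: (sup_ubound (proj2 d_sup)); exists k.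
  have dn : d N1 <= d n by apply: d_mono; rewrite (leq_trans _ nN)// leq_maxl.
  have dnk := d_mono _ _ nk.
  have := d_le n _ (K_mid Kn (K_decr nk Kk)).
  rewrite (psd_midpoint pB) => dmid.
  have e1 : B (w n) (w n) < d n + eps / 8.
    by apply: (lt_le_trans wn); rewrite lerD2l (le_trans in1)// ltW.
  have e2 : B (w k) (w k) < d k + eps / 8.
    by apply: (lt_le_trans wk); rewrite lerD2l (le_trans ik1)// ltW.
  lra.
have [l lP] := cB w_cauchy.
exists w, l; split=> //; first by move=> n; have [] := hw n.
move=> v Kv; apply/ler_addgt0Pr => eps e0; apply: (psd_limit_le pB) => eps' e'0.
have [N NP] := lP _ e'0; have [M _ MP] := near_infty_natSinv_lt (PosNum e0).
exists (w (maxn N M)); split; first by apply: NP; rewrite leq_maxl.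
have [_ /ltW h] := hw (maxn N M); apply: (le_trans h).
by apply: lerD; [exact: d_le | apply/ltW/(MP (maxn N M)); rewrite /= leq_maxr].
Qed.

End NestedMinimisers.

(** The representative is a multiple of a point [z] of least energy on the hyperplane [l = 1]:
    varying [z] along the kernel of [l] shows that it is orthogonal to this kernel. The bound by [C]
    keeps the limit of the minimising sequence on the hyperplane and makes [B z z] nonzero. *)
Lemma riesz B (l : V -> R) (C : R) : psd_form B -> form_complete B ->
  (forall a u v, l (a *: u + v) = a * l u + l v) ->
  (forall v, l v ^+ 2 <= C * B v v) ->
  exists w, forall v, B w v = l v.
Proof.
move=> pB cB llin lC; have bB := pB.1.
have l0 : l 0 = 0 by have := llin (-1) 0 0; rewrite scaler0 addr0 mulN1r addNr.
have lZ a u : l (a *: u) = a * l u by have := llin a u 0; rewrite !addr0 l0 addr0.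
have lD u v : l (u + v) = l u + l v by have := llin 1 u v; rewrite scale1r mul1r.
have lN u : l (- u) = - l u by rewrite -scaleN1r lZ mulN1r.
have [[v0 v0P]|no] := pselect (exists v, l v != 0); last first.
  exists 0 => v; rewrite (form0l bB); apply/esym/eqP/negPn/negP => h.
  by apply: no; exists v.
pose K (_ : nat) := [set v | l v = 1].
have [//| | |w [z [Kw wz wmin]]] := @nested_minimisers _ pB cB K
   (B ((l v0)^-1 *: v0) ((l v0)^-1 *: v0)).
- by move=> n u v; rewrite /K/= => hu hv; rewrite lZ lD hu hv; field.
- by move=> n; exists ((l v0)^-1 *: v0); split => //; rewrite /K/= lZ mulVf.
have lz : l z = 1.
  apply/eqP; rewrite -subr_eq0 -sqrf_eq0; apply/eqP/le_anti; rewrite sqr_ge0 andbT.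
  apply/ler_addgt0Pr => eps e0; rewrite add0r.
  have C1 : 0 < `|C| + 1 by have := normr_ge0 C; lra.
  have [N /(_ N (leqnn _)) hN] := wz (eps / (`|C| + 1)) (divr_gt0 e0 C1).
  have := lC (z - w N); rewrite lD lN (Kw N) => h; apply: (le_trans h).
  rewrite (psdBC pB); apply: (@le_trans _ _ ((`|C| + 1) * B (w N - z) (w N - z))).
    by apply: ler_wpM2r; [exact: psd_ge0 | have := ler_norm C; lra].
  by rewrite mulrC -ler_pdivlMr// ltW.
have orth v : l v = 0 -> B z v = 0.
  move=> lv; have h (a : R) : 0 <= 2 * a * B z v + a ^+ 2 * B v v.
    have := wmin (z + a *: v) (fun _ => _); rewrite /K/= lD lZ lz lv mulr0 addr0.
    by move=> /(_ (fun=> erefl)); rewrite !(formE bB) (formC bB v z); lra.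
  have := psd_ge0 pB v; rewrite le_eqVlt => /predU1P[v0'|v0'].
    exact: (psd_null_r pB).
  have := h (- B z v / B v v).
  have -> : 2 * (- B z v / B v v) * B z v + (- B z v / B v v) ^+ 2 * B v v
     = - (B z v ^+ 2 / B v v) by field; rewrite gt_eqF.
  rewrite oppr_ge0 pmulr_lle0 ?invr_gt0// => le0.
  by apply/eqP; rewrite -sqrf_eq0 eq_le le0 sqr_ge0.
have Bz0 : B z z != 0.
  by apply/eqP => z0; have := lC z; rewrite lz z0 mulr0 expr1n; lra.
exists ((B z z)^-1 *: z) => v.
have := orth (v - l v *: z); rewrite lD lN lZ lz mulr1 subrr => /(_ erefl).
by rewrite !(formE bB) => /subr0_eq ->; rewrite mulrCA mulVf ?mulr1.
Qed.

End BilinearForms.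

(** * Functional calculus of a positive contraction *)

Section FunctionalCalculus.
Variables (R : realType) (V : lmodType R) (T : V -> V).
Implicit Types (B : V -> V -> R) (c d : nat -> R) (phi psi : R -> R).

(** Both [M * B - L] and [M * B + L] are positive. Their Cauchy-Schwarz inequalities bound
    [(b - l) ^+ 2] and [(b + l) ^+ 2]; the product of the two, with the inequality of arithmetic and
    geometric means, bounds the mixed term of [4 * l ^+ 2] by [x1 * y2 + x2 * y1]. No constant is
    lost. *)
Lemma bilinear_bound (L B : V -> V -> R) (M : R) : sym_bilinear L -> psd_form B ->
  (forall u, `|L u u| <= M * B u u) ->
  forall u v, `|L u v| <= M * (Num.sqrt (B u u) * Num.sqrt (B v v)).
Proof.
move=> bL pB h u v; have bB := pB.1.
have [M0|M0] := ltP M 0.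
  have z w : B w w = 0.
    have := h w; have := psd_ge0 pB w; rewrite le_eqVlt => /predU1P[->//|w0].
    by have := nmulr_rlt0 (B w w) M0; rewrite w0 => /esym; have := normr_ge0 (L w w); lra.
  have z' w : L w w = 0.
    by apply/eqP; rewrite -normr_le0; have := h w; rewrite z mulr0.
  have := z' (u + v); rewrite !(formE bL) (formC bL v u) !z'.
  by rewrite !z sqrtr0 !mulr0 !addr0 add0r => h'; rewrite normr_le0; apply/eqP; lra.
have pP : psd_form (fun x y => M * B x y + L x y).
  split; first split=> [x y|a x y w]; first by rewrite (formC bB) (formC bL).
    by rewrite !(formE bB) !(formE bL); ring.
  by move=> x; have := h x; rewrite ler_norml => /andP[? ?]; lra.
have pN : psd_form (fun x y => M * B x y - L x y).
  split; first split=> [x y|a x y w]; first by rewrite (formC bB) (formC bL).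
    by rewrite !(formE bB) !(formE bL); ring.
  by move=> x; have := h x; rewrite ler_norml => /andP[? ?]; lra.
have := cauchy_schwarz pP u v; have := cauchy_schwarz pN u v.
have := pP.2 u; have := pP.2 v; have := pN.2 u; have := pN.2 v => /=.
set b := M * B u v; set l := L u v.
set x1 := M * B u u - _; set y1 := M * B v v - _.
set x2 := M * B u u + _; set y2 := M * B v v + _ => y1p x1p y2p x2p c1 c2.
have e1 : M * B u u = (x1 + x2) / 2 by rewrite /x1 /x2; field.
have e2 : M * B v v = (y1 + y2) / 2 by rewrite /y1 /y2; field.
have prod : ((b - l) * (b + l)) ^+ 2 <= (x1 * y2) * (x2 * y1).
  have -> : x1 * y2 * (x2 * y1) = x1 * y1 * (x2 * y2) by ring.
  by rewrite exprMn ler_pM ?sqr_ge0.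
have sq : l ^+ 2 <= M ^+ 2 * (B u u * B v v).
  have -> : M ^+ 2 * (B u u * B v v) = (M * B u u) * (M * B v v) by ring.
  have -> : l ^+ 2 = ((b - l) ^+ 2 + (b + l) ^+ 2 - 2 * ((b - l) * (b + l))) / 4 by field.
  rewrite e1 e2.
  have -> : (x1 + x2) / 2 * ((y1 + y2) / 2)
      = (x1 * y1 + x2 * y2 + (x1 * y2 + x2 * y1)) / 4 by field.
  rewrite ler_pM2r ?invr_gt0// lerD ?lerD//.
  move: (mulr_ge0 x1p y2p) (mulr_ge0 x2p y1p) prod.
  move: (x1 * y2) (x2 * y1) ((b - l) * (b + l)) => P Q p P0 Q0 pPQ.
  have [//|neg] := leP (- (2 * p)) 0; first by move/le_trans; apply; rewrite addr_ge0.
  rewrite -(ler_pXn2r (_ : 0 < 2)%N) ?nnegrE ?addr_ge0 ?(ltW neg)//.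
  by have := sqr_ge0 (P - Q); nra.
have sqs : Num.sqrt (l ^+ 2) <= Num.sqrt (M ^+ 2 * (B u u * B v v)).
  by rewrite ler_sqrt ?mulr_ge0 ?sqr_ge0 ?psd_ge0.
move: sqs; rewrite sqrtr_sqr (sqrtrM _ (sqr_ge0 _)) sqrtr_sqr (ger0_norm M0).
by rewrite sqrtrM// psd_ge0.
Qed.

(* [B] has [T] as a self-adjoint operator with spectrum in [0, 1]. *)
Definition spectral_form B : Prop :=
  [/\ sym_bilinear B, (forall f g, B (T f) g = B f (T g)),
      (forall f, 0 <= B f (T f)) & (forall f, B f (T f) <= B f f)].

(** In spectral terms, [mulT] and [mulCT] multiply the spectral measure of [B] by [x] and by
    [1 - x]. *)
Definition mulT B f g := B f (T g).
Definition mulCT B f g := B f g - B f (T g).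

Lemma spectral_psd B : spectral_form B -> psd_form B.
Proof. by case=> bB _ p1 p2; split=> // u; exact: le_trans (p1 u) (p2 u). Qed.

(** In spectral terms [x - x^2 = x (1 - x)^2 + x^2 (1 - x)]; the two summands are nonnegative by the
    bounds on [T] at [f - T f] and at [T f]. *)
Lemma spectral_TT B f : spectral_form B -> B (T f) (T f) <= B f (T f).
Proof.
case=> bB cB p1 p2.
have h : B (T f) (T (T f)) <= B (T f) (T f) := p2 _.
have := p1 (f - T f); rewrite (formBl bB) -!cB !(formBr bB) !cB.
have -> : B f (T (T f)) = B (T f) (T f) by rewrite cB.
by rewrite -cB; move: h; rewrite -!cB; lra.
Qed.

Lemma spectral_mulT B : spectral_form B -> spectral_form (mulT B).
Proof.
move=> sB; have [bB cB p1 p2] := sB; rewrite /mulT; split.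
- split=> [f g|a f g h]; first by rewrite -cB (formC bB).
  by rewrite !(formE bB).
- by move=> f g; rewrite cB.
- by move=> f; rewrite -cB; apply: (psd_ge0 (spectral_psd sB)).
- by move=> f; rewrite -cB; exact: spectral_TT.
Qed.

Lemma spectral_mulCT B : spectral_form B -> spectral_form (mulCT B).
Proof.
move=> sB; have [bB cB p1 p2] := sB; rewrite /mulCT; split.
- split=> [f g|a f g h]; first by rewrite -cB !(formC bB g).
  by rewrite !(formE bB); ring.
- by move=> f g; rewrite !cB.
- by move=> f; rewrite -(cB f (T f)) subr_ge0; exact: spectral_TT.
- move=> f; have := psd_ge0 (spectral_psd sB) (f - T f).
  by rewrite !(formE bB) (cB f f) -(cB f (T f)); lra.
Qed.

(* De Casteljau's algorithm: with [T] in place of the variable, the form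
   [B f (p(T) g)] of the polynomial [p] of degree [n] whose Bernstein
   coefficients are the first values of [c]. *)
Fixpoint bernstein n c B : V -> V -> R :=
  if n is n'.+1 then fun f g =>
    bernstein n' c (mulCT B) f g + bernstein n' (fun k => c k.+1) (mulT B) f g
  else fun f g => c 0%N * B f g.

Lemma bernstein_bilinear n c B : spectral_form B -> sym_bilinear (bernstein n c B).
Proof.
elim: n c B => [|n IH] c B sB /=.
  have [bB _ _ _] := sB.
  split=> [f g|a f g h]; first by rewrite (formC bB).
  by rewrite !(formE bB); ring.
have b1 := IH c _ (spectral_mulCT sB); have b2 := IH (fun k => c k.+1) _ (spectral_mulT sB).
split=> [f g|a f g h]; first by rewrite (formC b1) (formC b2).
by rewrite !(formE b1) !(formE b2); ring.
Qed.

Lemma bernstein_ge0 n c B f : spectral_form B -> (forall k, (k <= n)%N -> 0 <= c k) ->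
  0 <= bernstein n c B f f.
Proof.
elim: n c B => [|n IH] c B sB c0 /=.
  by rewrite mulr_ge0 ?c0//; exact: psd_ge0 (spectral_psd sB) f.
rewrite addr_ge0//; apply: IH.
- exact: spectral_mulCT.
- by move=> k kn; apply: c0; exact: leqW.
- exact: spectral_mulT.
- by move=> k kn; apply: c0.
Qed.

Lemma bernstein_linear n a c d B f g :
  bernstein n (fun k => a * c k + d k) B f g = a * bernstein n c B f g + bernstein n d B f g.
Proof. by elim: n c d B => [|n IH] c d B /=; rewrite ?IH; ring. Qed.

Lemma eq_bernstein n c d B f g : (forall k, (k <= n)%N -> c k = d k) ->
  bernstein n c B f g = bernstein n d B f g.
Proof.
elim: n c d B => [|n IH] c d B h /=; first by rewrite h.
by congr (_ + _); apply: IH => k kn; apply: h => //; exact: leqW.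
Qed.

Lemma bernstein_split n c B1 B2 B f g : (forall f g, B f g = B1 f g + B2 f g) ->
  bernstein n c B f g = bernstein n c B1 f g + bernstein n c B2 f g.
Proof.
elim: n c B1 B2 B f g => [|n IH] c B1 B2 B f g h /=; first by rewrite h mulrDr.
rewrite (IH c (mulCT B1) (mulCT B2) (mulCT B) f g) => [|x y]; last first.
  by rewrite /mulCT !h opprD addrACA.
rewrite (IH _ (mulT B1) (mulT B2) (mulT B) f g) => [|x y]; last by rewrite /mulT h.
by rewrite addrACA.
Qed.

Lemma mul_split B f g : B f g = mulCT B f g + mulT B f g.
Proof. by rewrite /mulCT /mulT subrK. Qed.

Lemma bernstein_cst n a B f g : bernstein n (fun=> a) B f g = a * B f g.
Proof. by elim: n B f g => [|n IH] B f g //=; rewrite !IH -mulrDr -mul_split. Qed.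

Lemma bernstein_mulT n c B f g : bernstein n c (mulT B) f g = bernstein n c B f (T g).
Proof.
elim: n c B => [//|n IH] c B /=.
by rewrite -!IH.
Qed.

(** The coefficients [M + c k] and [M - c k] are nonnegative and the constant [M] yields [M * B], so
    the quadratic form lies between [- M * B] and [M * B]. *)
Lemma bernstein_bound n c B M f g : spectral_form B ->
  (forall k, (k <= n)%N -> `|c k| <= M) ->
  `|bernstein n c B f g| <= M * (Num.sqrt (B f f) * Num.sqrt (B g g)).
Proof.
move=> sB cM; apply: bilinear_bound.
- exact: bernstein_bilinear.
- exact: spectral_psd.
move=> u; rewrite ler_norml; apply/andP; split.
  have : 0 <= bernstein n (fun k => 1 * c k + M) B u u.
    by apply: bernstein_ge0 => // k /cM; rewrite ler_norml => /andP[? ?]; lra.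
  by rewrite bernstein_linear bernstein_cst; lra.
have : 0 <= bernstein n (fun k => (-1) * c k + M) B u u.
  by apply: bernstein_ge0 => // k /cM; rewrite ler_norml => /andP[? ?]; lra.
by rewrite bernstein_linear bernstein_cst; lra.
Qed.

Lemma bernstein_dist n c d B M f g : spectral_form B ->
  (forall k, (k <= n)%N -> `|c k - d k| <= M) ->
  `|bernstein n c B f g - bernstein n d B f g| <= M * (Num.sqrt (B f f) * Num.sqrt (B g g)).
Proof.
move=> sB cd; have := bernstein_linear n (-1) d c B f g.
rewrite mulN1r addrC => <-; apply: bernstein_bound => // k /cd.
by rewrite mulN1r addrC.
Qed.

(** Writing [1 = (1 - x) + x] splits the form of degree [n] like the one of degree [n.+1]. The
    coefficients [c k] then face [d k] in the half with [1 - x] and [d k.+1] in the half with [x];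
    each half costs one [M]. *)
Lemma bernstein_elevation n c d B M f g : spectral_form B ->
  (forall k, (k <= n)%N -> `|d k - c k| <= M) ->
  (forall k, (k <= n)%N -> `|d k.+1 - c k| <= M) ->
  `|bernstein n.+1 d B f g - bernstein n c B f g|
    <= 2 * M * (Num.sqrt (B f f) * Num.sqrt (B g g)).
Proof.
move=> sB h1 h2 /=; have M0 : 0 <= M := le_trans (normr_ge0 _) (h1 0%N (leq0n _)).
rewrite (@bernstein_split n c (mulCT B) (mulT B)); last by move=> *; exact: mul_split.
rewrite opprD addrACA (le_trans (ler_normD _ _))//.
have [_ _ p1 p2] := sB; have pB := spectral_psd sB.
have le1 x : Num.sqrt (mulCT B x x) <= Num.sqrt (B x x).
  by rewrite ler_sqrt ?psd_ge0// /mulCT; have := p1 x; lra.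
have le2 x : Num.sqrt (mulT B x x) <= Num.sqrt (B x x).
  by rewrite ler_sqrt ?psd_ge0// /mulT; have := p2 x; lra.
rewrite -mulrA mulrDl mul1r -[in leRHS]/(1 + 1); apply: lerD.
  apply: le_trans (bernstein_dist _ _ (spectral_mulCT sB) h1) _.
  by rewrite ler_wpM2l// ler_pM ?sqrtr_ge0.
apply: le_trans (bernstein_dist _ _ (spectral_mulT sB) h2) _.
by rewrite ler_wpM2l// ler_pM ?sqrtr_ge0.
Qed.

(** This is [k * binom(n + 1, k) = (n + 1) * binom(n, k - 1)]: up to the weights [k / (n + 1)],
    multiplication by [x] shifts Bernstein coefficients. *)
Lemma bernstein_shift n d B f g :
  bernstein n.+1 (fun k => k%:R * d k) B f g
  = n.+1%:R * bernstein n (fun k => d k.+1) (mulT B) f g.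
Proof.
elim: n d B => [|n IH] d B; first by rewrite /= !mul0r add0r mulrA.
have -> : bernstein n.+2 (fun k => k%:R * d k) B f g =
   bernstein n.+1 (fun k => k%:R * d k) (mulCT B) f g +
   bernstein n.+1 (fun k => k.+1%:R * d k.+1) (mulT B) f g by [].
rewrite IH; have -> : bernstein n.+1 (fun k => k.+1%:R * d k.+1) (mulT B) f g =
   bernstein n.+1 (fun k => 1 * (k%:R * d k.+1) + d k.+1) (mulT B) f g.
  by apply: eq_bernstein => k _; rewrite -natr1 mulrDl !mul1r.
rewrite bernstein_linear (IH (fun k => d k.+1)) mul1r [in RHS]/= -[in RHS]natr1 -/(bernstein n.+1).
set a := bernstein n (fun k => d k.+1) _ f g.
set b := bernstein n (fun k => d k.+2) _ f g.
have -> : bernstein n.+1 (fun k => d k.+1) (mulT B) f g = a + b by [].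
rewrite -/a; set m := n.+1%:R; ring.
Qed.

End FunctionalCalculus.

(** * Limits of Bernstein forms along an ultrafilter *)

Section SpectralFunctional.
Variables (R : realType) (V : lmodType R) (T : V -> V) (q : V -> V -> R).
Hypothesis sq : spectral_form T q.
Variable U : set_system nat.
Hypotheses (UU : UltraFilter U) (Uoo : \oo `<=` U).
Implicit Types (phi psi : R -> R) (f g : V).

Local Notation nq f := (Num.sqrt (q f f)).

Lemma ultra_fmap (S : Type) (a : nat -> S) : UltraFilter (a @ U).
Proof.
split=> [|G GF sUG]; first exact: fmap_proper_filter.
rewrite predeqE => A; split; last exact: sUG.
move=> GA; have [//|UnA] := in_ultra_setVsetC (a @^-1` A) UU.
have GnA : G (~` A) by exact: sUG.
by have /filter_ex [? []] : G (A `&` ~` A) by exact: filterI.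
Qed.

Lemma ultra_bounded_cvg (a : nat -> R) (M : R) : (forall n, `|a n| <= M) ->
  a n @[n --> U] --> lim (a n @[n --> U]).
Proof.
move=> aM; have := @segment_compact R (- M) M.
rewrite compact_ultra => /(_ (a @ U) (ultra_fmap a)) h.
have [|l [_ lP]] := h.
  by apply: (@filterE _ U) => n /=; rewrite in_itv/= -ler_norml.
by apply/cvg_ex; exists l.
Qed.

Definition bounded01 phi := exists M, forall x, 0 <= x <= 1 -> `|phi x| <= M.

Definition unif_continuous01 phi := forall eps : R, 0 < eps -> exists d : R, 0 < d /\
  forall x y, 0 <= x <= 1 -> 0 <= y <= 1 -> `|x - y| < d -> `|phi x - phi y| <= eps.

Definition bernstein_approx n phi f g :=
  bernstein T n (fun k => phi (k%:R / n%:R)) q f g.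

(* The quadratic form of [phi(T)]: a limit along an ultrafilter of the
   Bernstein approximations exists without any regularity of [phi]. *)
Definition calculus phi f g := lim (bernstein_approx n phi f g @[n --> U]).

Lemma ratio01 n k : (k <= n)%N -> 0 <= (k%:R / n%:R : R) <= 1.
Proof.
move=> kn; rewrite divr_ge0//=; case: n kn => [|n] kn; first by rewrite invr0 mulr0.
by rewrite ler_pdivrMr ?ltr0n// mul1r ler_nat.
Qed.

Lemma bernstein_approx_bound n phi M f g : (forall x, 0 <= x <= 1 -> `|phi x| <= M) ->
  `|bernstein_approx n phi f g| <= M * (nq f * nq g).
Proof. by move=> h; apply: bernstein_bound => // k kn; apply: h; exact: ratio01. Qed.

Lemma calculus_cvg phi f g : bounded01 phi ->
  bernstein_approx n phi f g @[n --> U] --> calculus phi f g.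
Proof.
move=> [M h]; apply: (@ultra_bounded_cvg _ (M * (nq f * nq g))) => n.
exact: bernstein_approx_bound.
Qed.

Lemma calculus_bound phi M f g : (forall x, 0 <= x <= 1 -> `|phi x| <= M) ->
  `|calculus phi f g| <= M * (nq f * nq g).
Proof.
move=> h; have c := @calculus_cvg phi f g (ex_intro _ M h).
rewrite -(cvg_lim (@Rhausdorff R) (cvg_norm c)).
apply: limr_le; first by apply/cvg_ex; exists `|calculus phi f g|; exact: cvg_norm.
by apply: (@filterE _ U) => n; exact: bernstein_approx_bound.
Qed.

Lemma calculus_bilinear phi : bounded01 phi -> sym_bilinear (calculus phi).
Proof.
move=> bphi; have b n : sym_bilinear (bernstein_approx n phi) by exact: bernstein_bilinear.
split=> [f g|a f g h].
  rewrite /calculus (_ : (fun n => bernstein_approx n phi f g) =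
    fun n => bernstein_approx n phi g f)//.
  by apply/funext => n; rewrite (formC (b n)).
apply: (cvg_lim (@Rhausdorff R)).
rewrite (_ : (fun n => _) = fun n => a * bernstein_approx n phi f h + bernstein_approx n phi g h).
  by apply: cvgD; [apply: cvgMr|]; exact: calculus_cvg.
by apply/funext => n; rewrite (b n).2.
Qed.

Lemma calculus_linear a phi psi f g : bounded01 phi -> bounded01 psi ->
  calculus (fun x => a * phi x + psi x) f g = a * calculus phi f g + calculus psi f g.
Proof.
move=> b1 b2; apply: (cvg_lim (@Rhausdorff R)).
rewrite (_ : (fun n => _) = fun n => a * bernstein_approx n phi f g + bernstein_approx n psi f g).
  by apply: cvgD; [apply: cvgMr|]; exact: calculus_cvg.
by apply/funext => n; exact: bernstein_linear.
Qed.

Lemma calculus_cst a f g : calculus (fun=> a) f g = a * q f g.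
Proof.
apply: (cvg_lim (@Rhausdorff R)).
rewrite (_ : (fun n => _) = fun n => a * q f g); first exact: cvg_cst.
by apply/funext => n; exact: bernstein_cst.
Qed.

Lemma eq_calculus phi psi f g : (forall x, 0 <= x <= 1 -> phi x = psi x) ->
  calculus phi f g = calculus psi f g.
Proof.
move=> h; rewrite /calculus (_ : (fun n => bernstein_approx n phi f g) =
  fun n => bernstein_approx n psi f g)//.
apply/funext => n; apply: eq_bernstein => k kn; apply: h; exact: ratio01.
Qed.

(** The differences are [- (k / n) / (n + 1)] and [(1 - k / n) / (n + 1)], where [k / n] lies in
    [[0, 1]]; for [n = 0] it is 0 by the convention on inverses. *)
Lemma ratio_dist n k : (k <= n)%N ->
  `|k%:R / n.+1%:R - k%:R / n%:R| <= n.+1%:R^-1 :> R /\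
  `|k.+1%:R / n.+1%:R - k%:R / n%:R| <= n.+1%:R^-1 :> R.
Proof.
case: n => [|n] kn.
  move: kn; rewrite leqn0 => /eqP ->; rewrite !mul0r subrr subr0 normr0.
  by rewrite normrM normr1 mul1r ger0_norm invr_ge0.
have n1 : 0 < n.+1%:R :> R by rewrite ltr0n.
have n2 : 0 < n.+2%:R :> R by rewrite ltr0n.
have kn' : k%:R <= n.+1%:R :> R by rewrite ler_nat.
have e : n.+2%:R = n.+1%:R + 1 :> R by rewrite natr1.
have e' : k.+1%:R = k%:R + 1 :> R by rewrite natr1.
have k0 : 0 <= k%:R :> R by rewrite ler0n.
move: n1 n2 kn' k0; rewrite e e'; move: (k%:R) (n.+1%:R) => x y y0 y1 xy x0.
have r : x / y <= 1 by rewrite ler_pdivrMr// mul1r.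
have r0 : 0 <= x / y by rewrite divr_ge0// ltW.
have i0 : 0 <= (y + 1)^-1 by rewrite invr_ge0 ltW.
split.
  have -> : x / (y + 1) - x / y = - ((x / y) * (y + 1)^-1) by field; rewrite !gt_eqF.
  by rewrite normrN ger0_norm; [exact: ler_piMl|exact: mulr_ge0].
have -> : (x + 1) / (y + 1) - x / y = (1 - x / y) * (y + 1)^-1 by field; rewrite !gt_eqF.
have r1 : 0 <= 1 - x / y by rewrite subr_ge0.
rewrite ger0_norm; last exact: mulr_ge0.
by apply: ler_piMl => //; rewrite gerBl.
Qed.

Lemma unif_ratio_dist phi (eps : R) : unif_continuous01 phi -> 0 < eps ->
  exists N, forall n k, (N <= n)%N -> (k <= n)%N ->
    `|phi (k%:R / n.+1%:R) - phi (k%:R / n%:R)| <= eps /\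
    `|phi (k.+1%:R / n.+1%:R) - phi (k%:R / n%:R)| <= eps.
Proof.
move=> uphi e0; have [d [d0 dP]] := uphi _ e0.
have [N _ NP] := near_infty_natSinv_lt (PosNum d0).
exists N => n k Nn kn; have [h1 h2] := ratio_dist kn.
have nd : (n.+1%:R : R)^-1 < d by exact: NP.
split; apply: dP; rewrite ?ratio01 ?(le_lt_trans _ nd)//; exact: leqW.
Qed.

Lemma ultra_lim_eq (a b : nat -> R) (l C : R) :
  (forall eps : R, 0 < eps -> exists N, forall n, (N <= n)%N -> `|a n - b n| <= eps * C) ->
  a n @[n --> U] --> l -> b n @[n --> U] --> l.
Proof.
move=> h al; rewrite -[l]addr0 (_ : b = fun n => a n + (b n - a n)); last first.
  by apply/funext => n; rewrite addrC subrK.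
apply: cvgD => //; apply/cvgrPdist_le => e e0; apply: Uoo.
have C0 : 0 < `|C| + 1 by have := normr_ge0 C; lra.
have [N NP] := h _ (divr_gt0 e0 C0); exists N => // n /= /NP.
rewrite sub0r opprB => /le_trans; apply.
rewrite mulrAC ler_pdivrMr// ler_pM2l//; have := ler_norm C; lra.
Qed.

(** The only multiplicativity of the calculus that the heat flow requires. By [bernstein_shift], the
    approximation [b n] of [x * psi x] in degree [n.+1] is exactly a form of degree [n] for [mulT],
    with [psi] taken at [(k + 1) / (n + 1)]. It remains to move these nodes to [k / n], and to
    compare the degrees [n.+1] and [n] for [x * psi x]. *)
Lemma calculus_mulT psi f g : unif_continuous01 psi ->
  unif_continuous01 (fun x => x * psi x) -> bounded01 (fun x => x * psi x) ->
  calculus psi f (T g) = calculus (fun x => x * psi x) f g.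
Proof.
move=> u1 u2 b2; apply: (cvg_lim (@Rhausdorff R)).
pose b n := bernstein_approx n.+1 (fun x => x * psi x) f g.
apply: (@ultra_lim_eq b _ _ (Num.sqrt (mulT T q f f) * Num.sqrt (mulT T q g g))).
  move=> eps e0; have [N NP] := unif_ratio_dist u1 e0; exists N => n Nn.
  have -> : b n = bernstein T n (fun k => psi (k.+1%:R / n.+1%:R)) (mulT T q) f g.
    have n0 : n.+1%:R != 0 :> R by rewrite pnatr_eq0.
    apply: (mulfI n0); rewrite -(bernstein_shift T n (fun k => psi (k%:R / n.+1%:R))).
    rewrite -[LHS]addr0 -(mul0r (q f g)) -(bernstein_cst T n.+1 0) -bernstein_linear.
    by apply: eq_bernstein => k _; rewrite addr0; field.
  rewrite /bernstein_approx -bernstein_mulT.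
  apply: bernstein_dist; first exact: spectral_mulT.
  by move=> k kn; have [] := NP n k Nn kn.
apply: (@ultra_lim_eq (fun n => bernstein_approx n (fun x => x * psi x) f g) _ _
  (2 * (nq f * nq g))).
  move=> eps e0; have [N NP] := unif_ratio_dist u2 e0; exists N => n Nn.
  rewrite distrC mulrCA mulrA; apply: bernstein_elevation => // k kn; by have [] := NP n k Nn kn.
exact: calculus_cvg.
Qed.

End SpectralFunctional.

(** * The heat flow of a closed form *)

Section HeatMultiplier.
Variable R : realType.
Implicit Types (s t x y : R) (phi psi : R -> R).

Lemma is_derive_eps (F : R -> R) t d :
  (forall eps : R, 0 < eps -> exists eta : R, 0 < eta /\
     forall h, h != 0 -> `|h| < eta -> `|F (t + h) - F t - h * d| <= eps * `|h|) ->
  is_derive t 1 F d.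
Proof.
move=> H; suff c : h^-1 *: ((F \o shift t) (h *: (1 : R)) - F t) @[h --> 0^'] --> d.
  apply: DeriveDef; first by apply/cvg_ex; exists d.
  exact: (cvg_lim (@Rhausdorff R)).
apply/cvgrPdist_le => eps e0; have [eta [eta0 etaP]] := H _ e0.
exists eta => // h; rewrite /ball_ /= sub0r normrN => h_eta h0.
have := etaP h h0 h_eta; rewrite /= /shift /= [h *: 1]mulr1 [h + t]addrC => le.
rewrite distrC -(ler_pM2r (_ : 0 < `|h|)) ?normr_gt0// -normrM mulrBl.
by rewrite [_ *: _]/(_ * _) mulrAC mulVf// mul1r [d * h]mulrC.
Qed.

Definition lipschitz01 phi := exists K : R, 0 <= K /\
  forall x y, 0 <= x <= 1 -> 0 <= y <= 1 -> `|phi x - phi y| <= K * `|x - y|.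

Lemma lipschitz_unif phi : lipschitz01 phi -> unif_continuous01 phi.
Proof.
move=> [K [K0 KP]] eps e0; have K1 : 0 < K + 1 by rewrite ltr_wpDl.
exists (eps / (K + 1)); split; first exact: divr_gt0.
move=> x y x01 y01 /ltW xy; apply: le_trans (KP _ _ x01 y01) _.
apply: (@le_trans _ _ ((K + 1) * `|x - y|)); first by rewrite ler_wpM2r// lerDl.
by rewrite mulrC -ler_pdivlMr.
Qed.

Lemma lipschitz_bounded phi : lipschitz01 phi -> bounded01 phi.
Proof.
move=> [K [K0 KP]]; exists (`|phi 0| + K) => x x01.
have o01 : 0 <= (0 : R) <= 1 by rewrite lexx ler01.
rewrite -[phi x](subrK (phi 0)) (le_trans (ler_normD _ _))// addrC lerD2l.
rewrite (le_trans (KP _ _ x01 o01))// subr0 ler_piMr//.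
by have /andP[x0 x1] := x01; rewrite ger0_norm.
Qed.

Lemma lipschitz_id : lipschitz01 id.
Proof. by exists 1; split=> // x y _ _; rewrite mul1r. Qed.

Lemma lipschitz_sub_cst phi a : lipschitz01 phi -> lipschitz01 (fun x => phi x - a).
Proof.
move=> [K [K0 KP]]; exists K; split=> // x y x01 y01.
by rewrite opprB addrA subrK; exact: KP.
Qed.

Lemma lipschitzM phi psi : lipschitz01 phi -> lipschitz01 psi ->
  lipschitz01 (fun x => phi x * psi x).
Proof.
move=> L1 L2; have [M1 M1P] := lipschitz_bounded L1; have [M2 M2P] := lipschitz_bounded L2.
have [K1 [K10 K1P]] := L1; have [K2 [K20 K2P]] := L2.
have o01 : 0 <= (0 : R) <= 1 by rewrite lexx ler01.
have M10 := le_trans (normr_ge0 _) (M1P _ o01).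
have M20 := le_trans (normr_ge0 _) (M2P _ o01).
exists (M1 * K2 + M2 * K1); split; first by rewrite addr_ge0 ?mulr_ge0.
move=> x y x01 y01.
have -> : phi x * psi x - phi y * psi y = phi x * (psi x - psi y) + psi y * (phi x - phi y) by ring.
rewrite (le_trans (ler_normD _ _))// !normrM mulrDl -!mulrA.
by apply: lerD; apply: ler_pM => //; [exact: M1P | exact: K2P | exact: M2P | exact: K1P].
Qed.

(* [heat_mul t] is the multiplier of the heat semigroup when the generator is
   [T^-1 - 1]; [heat_div t x = heat_mul t x / x].  As [0^-1 = 0], both vanish
   at [x = 0], which for [t > 0] is their continuous extension. *)
Definition heat_div t x := x^-1 * expR (- t * (x^-1 - 1)).
Definition heat_mul t x := x * heat_div t x.

Lemma heat_mulE t x : x != 0 -> heat_mul t x = expR (- t * (x^-1 - 1)).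
Proof. by move=> x0; rewrite /heat_mul /heat_div mulrA mulfV// mul1r. Qed.

Lemma heat_mul0 t : heat_mul t 0 = 0. Proof. by rewrite /heat_mul mul0r. Qed.

Lemma heat_div0 t : heat_div t 0 = 0. Proof. by rewrite /heat_div invr0 mul0r. Qed.

(** Here [b] stands for [1 / x]. The cube is the highest power in the derivative of [heat_div], and
    6 comes from the cubic term of the exponential series at [t * b]. *)
Lemma cube_exp_bound t b : 0 < t -> 1 <= b ->
  b ^+ 3 * expR (- t * (b - 1)) <= 6 * expR t / t ^+ 3.
Proof.
move=> t0 b1; have b0 : 0 <= b by lra.
have -> : - t * (b - 1) = t - t * b by ring.
rewrite expRD expRN ler_pdivlMr ?exprn_gt0//.
have tb : 0 <= t * b by rewrite mulr_ge0// ltW.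
have := expR_ge1Dxn 2 tb; rewrite -[(3`!)%:R]/(6%:R) exprMn => h.
have E0 := expR_gt0 (t * b); have F0 := expR_gt0 t.
have -> : b ^+ 3 * (expR t * (expR (t * b))^-1) * t ^+ 3
  = (t ^+ 3 * b ^+ 3) * expR t / expR (t * b) by field; rewrite gt_eqF.
rewrite ler_pdivrMr// [leRHS]mulrAC ler_pM2r//; lra.
Qed.

Lemma heat_div_derive t x : x != 0 ->
  is_derive x (1 : R) (heat_div t) ((t * x^-1 ^+ 3 - x^-1 ^+ 2) * expR (- t * (x^-1 - 1))).
Proof.
move=> x0; have dinv : is_derive x (1 : R) (fun y : R => y^-1) (- x ^- 2).
  by apply: is_derive_eq; [exact: is_deriveV | rewrite [_ *: _]mulr1].
have dlin : is_derive x (1 : R) ((- t) *: ((fun y : R => y^-1) - cst 1)) (- t *: (- x ^- 2 - 0)).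
  by apply: is_deriveZ; apply: is_deriveB.
have dexp := @is_derive1_comp _ _ _ _ _ _ (is_derive_expR _) dlin.
have -> : heat_div t = (fun y : R => y^-1) * (expR \o ((- t) *: ((fun y : R => y^-1) - cst 1))).
  by apply/funext => y.
apply: (is_derive_eq (is_deriveM dinv dexp)).
have sE (a b : R) : a *: b = a * b by [].
have -> : ((- t) *: ((fun y : R => y^-1) - cst 1)) x = - t * (x^-1 - 1) by [].
by rewrite /= !sE; field.
Qed.

(** With [b = 1 / x >= 1], the derivative is at most [(t + 1) * b ^+ 3] times the exponential, which
    [cube_exp_bound] controls uniformly. *)
Lemma heat_div_lipschitz t : 0 < t -> lipschitz01 (heat_div t).
Proof.
move=> t0; set C := 6 * expR t / t ^+ 3.
have C0 : 0 <= C.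
  by apply: divr_ge0; [rewrite mulr_ge0// expR_ge0 | rewrite exprn_ge0// ltW].
exists ((t + 1) * C); split; first by rewrite mulr_ge0// addr_ge0// ltW.
move=> x y; wlog xy : x y / x < y => [th|].
  have [xy|yx|->] := ltgtP x y => x01 y01; first exact: th.
    by rewrite distrC [`|x - y|]distrC; exact: th.
  by rewrite !subrr normr0 mulr0.
move=> /andP[x0 _] /andP[_ y1]; have y0 : 0 < y := le_lt_trans x0 xy.
have inv_ge1 (z : R) : 0 < z -> z <= 1 -> 1 <= z^-1 by move=> z0 z1; rewrite invf_ge1.
rewrite distrC [`|x - y|]distrC [`|y - x|]ger0_norm; last by rewrite subr_ge0 ltW.
move: x0; rewrite le_eqVlt => /predU1P[x0|x0].
  (* The derivative formula excludes the endpoint 0; there the value at [y] is at most [C * y ^+ 2],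
     hence at most [C * y]. *)
  rewrite -x0 heat_div0 !subr0 /heat_div.
  have := cube_exp_bound t0 (inv_ge1 _ y0 y1); rewrite -/C; set E := expR _ => h.
  have -> : y^-1 * E = (y^-1 ^+ 3 * E) * y ^+ 2 by field; rewrite gt_eqF.
  have yi : 0 <= y^-1 by rewrite invr_ge0 ltW.
  have E0 : 0 <= E := expR_ge0 _.
  rewrite ger0_norm; last by rewrite mulr_ge0 ?sqr_ge0// mulr_ge0// exprn_ge0.
  apply: (@le_trans _ _ (C * y)); last first.
    by rewrite ler_pM2r// mulrDl mul1r lerDr mulr_ge0// ltW.
  apply: ler_pM; rewrite ?sqr_ge0//; first by rewrite mulr_ge0// exprn_ge0.
  by rewrite expr2 ler_piMr// ltW.
have inxy (z : R) : z \in `[x, y] -> 0 < z /\ z <= 1.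
  rewrite in_itv/= => /andP[xz zy]; split; first exact: lt_le_trans xz.
  exact: le_trans y1.
have [||c cxy ->] := @MVT R (heat_div t)
    (fun z => (t * z^-1 ^+ 3 - z^-1 ^+ 2) * expR (- t * (z^-1 - 1))) _ _ xy.
- move=> z zxy; apply: heat_div_derive.
  by have [z0 _] := inxy z (subset_itv_oo_cc zxy); rewrite gt_eqF.
- apply: derivable_within_continuous => z zxy.
  have [z0 _] := inxy z zxy; have zn : z != 0 by rewrite gt_eqF.
  exact: (@ex_derive _ _ _ _ _ _ _ (heat_div_derive t zn)).
- have [c0 c1] : 0 < c /\ c <= 1 by apply: inxy; exact: subset_itv_oo_cc cxy.
  rewrite normrM [`|y - x|]ger0_norm ?subr_ge0 ?(ltW xy)// ler_wpM2r ?subr_ge0 ?(ltW xy)//.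
  have b1 := inv_ge1 _ c0 c1; have := cube_exp_bound t0 b1; rewrite -/C.
  rewrite normrM (ger0_norm (expR_ge0 _)).
  move: b1 (expR_ge0 (- t * (c^-1 - 1))); move: (c^-1) (expR _) => b E b1 E0 h.
  have b2 : 1 <= b ^+ 2 by rewrite exprn_ege1.
  have b3 : b ^+ 2 <= b ^+ 3 by rewrite [leRHS]exprS ler_peMl ?sqr_ge0.
  apply: (@le_trans _ _ ((t + 1) * (b ^+ 3 * E))); last by rewrite ler_pM2l//; lra.
  rewrite [leRHS]mulrA ler_wpM2r// ler_norml; apply/andP.
  have := mulr_ge0 (ltW t0) (le_trans ler01 (le_trans b2 b3)); split; lra.
Qed.

Lemma heat_mul_lipschitz t : 0 < t -> lipschitz01 (heat_mul t).
Proof. by move=> t0; exact: lipschitzM lipschitz_id (heat_div_lipschitz t0). Qed.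

Lemma exp_taylor2 x : 0 <= expR (- x) - 1 + x <= x ^+ 2 * expR `|x|.
Proof.
have h1 := expR_ge1Dx (- x).
have h2 : expR (- x) * (1 + x) <= 1.
  have := expR_ge1Dx x; rewrite -(ler_pM2l (expR_gt0 (- x))).
  by rewrite -expRD addNr expR0.
apply/andP; split; first lra.
have [x0|x0] := leP 0 x.
  have e1 : 1 <= expR x by have := expR_ge1Dx x; lra.
  rewrite ger0_norm//; apply: (@le_trans _ _ (x ^+ 2)); last by rewrite ler_peMr ?sqr_ge0.
  have := ler_wpM2l x0 h1; lra.
rewrite ltr0_norm//; have nx : 0 <= - x by lra.
have := ler_wpM2l nx h2; lra.
Qed.

(** With [a = 1 / x - 1], the time derivative of [exp(- t a)] is [- a exp(- t a)], that is
    [heat_mul - heat_div]. As [|s - t| <= t / 2], half of the decay [exp(- t a)] absorbs the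
    exponential in the remainder and the other half absorbs [a ^+ 2], because
    [(t a / 2)^2 / 2 <= exp(t a / 2)]; this gives [8 / t ^+ 2]. *)
Lemma heat_mul_taylor s t x : 0 < t -> `|s - t| <= t / 2 -> 0 <= x <= 1 ->
  `|heat_mul s x - heat_mul t x + (s - t) * (heat_div t x - heat_mul t x)|
    <= 8 / t ^+ 2 * (s - t) ^+ 2.
Proof.
move=> t0 st /andP[]; rewrite le_eqVlt => /predU1P[<- _|x0 x1].
  rewrite !heat_mul0 heat_div0 !subrr mulr0 addr0 normr0.
  by rewrite mulr_ge0 ?sqr_ge0// divr_ge0 ?sqr_ge0.
have xn : x != 0 by rewrite gt_eqF.
rewrite !heat_mulE// /heat_div; have b1 : 1 <= x^-1 by rewrite invf_ge1.
move: b1; move: (x^-1) => b b1.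
set a := b - 1; have a0 : 0 <= a by rewrite subr_ge0.
have -> : expR (- s * a) - expR (- t * a) + (s - t) * (b * expR (- t * a) - expR (- t * a))
  = expR (- t * a) * (expR (- ((s - t) * a)) - 1 + (s - t) * a).
  have -> : - s * a = - t * a + - ((s - t) * a) by ring.
  by rewrite expRD /a; ring.
have /andP[l u] := exp_taylor2 ((s - t) * a).
rewrite ger0_norm ?mulr_ge0 ?expR_ge0//.
have u' : expR (- ((s - t) * a)) - 1 + (s - t) * a <= ((s - t) * a) ^+ 2 * expR (t / 2 * a).
  by apply: (le_trans u); rewrite ler_wpM2l ?sqr_ge0// ler_expR normrM (ger0_norm a0) ler_wpM2r.
apply: (le_trans (ler_wpM2l (expR_ge0 _) u')).
have ta : 0 <= t / 2 * a by rewrite mulr_ge0// divr_ge0// ltW.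
have := expR_ge1Dxn 1 ta; rewrite -[(2`!)%:R]/(2%:R) => h.
have E0 := expR_gt0 (t / 2 * a).
have -> : - t * a = - (t / 2 * a) - (t / 2 * a) by field.
rewrite expRD expRN; move: h E0; set E := expR _ => h E0.
have -> : E^-1 / E * (((s - t) * a) ^+ 2 * E) = (a ^+ 2 / E) * (s - t) ^+ 2 by field; rewrite gt_eqF.
rewrite ler_wpM2r ?sqr_ge0// ler_pdivrMr// mulrAC ler_pdivlMr ?exprn_gt0//.
have -> : a ^+ 2 * t ^+ 2 = 8 * ((t / 2 * a) ^+ 2 / 2) by field.
by rewrite ler_pM2l//; lra.
Qed.

Lemma heat_mul_contract s x : 0 < s -> 0 <= x <= 1 -> `|heat_mul s x - 1| <= 1.
Proof.
move=> s0 /andP[]; rewrite le_eqVlt => /predU1P[<- _|x0 x1].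
  by rewrite heat_mul0 sub0r normrN1.
have xn : x != 0 by rewrite gt_eqF.
rewrite heat_mulE//; have b1 : 1 <= x^-1 by rewrite invf_ge1.
have e1 : expR (- s * (x^-1 - 1)) <= 1.
  by rewrite -[leRHS]expR0 ler_expR mulNr oppr_le0 mulr_ge0 ?subr_ge0// ltW.
have := expR_ge0 (- s * (x^-1 - 1)); rewrite ler_norml => e0.
by apply/andP; split; lra.
Qed.

(** Without the factor [x] nothing tends to 0 uniformly, since [heat_mul s 0 = 0] for every [s].
    Initial values of the form [T g] supply this factor. *)
Lemma heat_mul_initial s x : 0 < s -> 0 <= x <= 1 -> `|x * (heat_mul s x - 1)| <= s.
Proof.
move=> s0 /andP[]; rewrite le_eqVlt => /predU1P[<- _|x0 x1].
  by rewrite mul0r normr0 ltW.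
have xn : x != 0 by rewrite gt_eqF.
rewrite heat_mulE//; have h := expR_ge1Dx (- s * (x^-1 - 1)).
have le0 : expR (- s * (x^-1 - 1)) - 1 <= 0.
  have b1 : 1 <= x^-1 by rewrite invf_ge1.
  by rewrite subr_le0 -[leRHS]expR0 ler_expR mulNr oppr_le0 mulr_ge0 ?subr_ge0// ltW.
rewrite normrM (ger0_norm (ltW x0)) ler0_norm//.
apply: (@le_trans _ _ (x * (s * (x^-1 - 1)))); first by rewrite ler_pM2l//; lra.
have -> : x * (s * (x^-1 - 1)) = s * (1 - x) by field.
by rewrite ler_piMr ?(ltW s0)//; lra.
Qed.

End HeatMultiplier.

(** * The semigroup of an abstract closed form *)

Section AbstractForm.
Variables (R : realType) (V W : lmodType R) (iota : {linear W -> V}).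
Variables (q : V -> V -> R) (e : W -> W -> R).
Hypotheses (pq : psd_form q) (pe : psd_form e).

Definition form1 (w w' : W) : R := e w w' + q (iota w) (iota w').

Hypothesis complete1 : form_complete form1.

Let bq := pq.1.
Let be := pe.1.
Local Notation nq f := (Num.sqrt (q f f)).

Lemma form1_psd : psd_form form1.
Proof.
split=> [|w]; last by rewrite addr_ge0 ?(psd_ge0 pe) ?(psd_ge0 pq).
split=> [w w'|a w w' v]; rewrite /form1; first by rewrite (formC be) (formC bq).
by rewrite linearP !(formE be) !(formE bq); ring.
Qed.

Let p1 := form1_psd.
Let b1 := p1.1.

Lemma form1_ge_q w : q (iota w) (iota w) <= form1 w w.
Proof. by rewrite lerDr psd_ge0. Qed.

Lemma form1_ge_e w : e w w <= form1 w w.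
Proof. by rewrite lerDl psd_ge0. Qed.

(* Mazur's lemma and lower semicontinuity in one step: apply
   [nested_minimisers] to the sets of [w] in [P] of energy at most [C] that are
   close to [x] for [q]. *)
Lemma form_lsc (P : set W) (x : V) (C : R) :
  (forall u v, P u -> P v -> P (2^-1 *: (u + v))) ->
  (forall w l, (forall n, P (w n)) ->
     (forall eps : R, 0 < eps -> exists N, forall n, (N <= n)%N ->
        form1 (w n - l) (w n - l) < eps) -> P l) ->
  (forall eps : R, 0 < eps ->
     exists w, [/\ P w, q (iota w - x) (iota w - x) <= eps & e w w <= C]) ->
  exists w, [/\ P w, q (iota w - x) (iota w - x) = 0 & e w w <= C].
Proof.
move=> Pmid Plim Papp.
pose K n := [set w | [/\ P w, q (iota w - x) (iota w - x) <= n.+1%:R^-1 & e w w <= C]].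
have inv0 n : 0 < (n.+1%:R : R)^-1 by rewrite invr_gt0 ltr0n.
(* The bound: [e w w <= C], and [q] at [iota w] is at most twice its value at [iota w - x], which is
   at most 1, plus [2 * q x x]. *)
have [| | |w [l [Kw wl _]]] := @nested_minimisers _ _ _ p1 complete1 K (C + (2 + 2 * q x x)).
- move=> n k v nk [Pv qv ev]; split=> //; apply: (le_trans qv).
  by rewrite lef_pV2 ?posrE ?ltr0n// ler_nat.
- move=> n u v [Pu qu eu] [Pv qv ev]; split; [exact: Pmid| |exact: psd_midpoint_le].
  have -> : iota (2^-1 *: (u + v)) - x = 2^-1 *: ((iota u - x) + (iota v - x)).
    rewrite linearZ linearD /= addrACA -opprD scalerBr -[x + x]mulr2n.
    by rewrite -[x *+ 2]scaler_nat scalerA mulVf ?scale1r// pnatr_eq0.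
  exact: psd_midpoint_le.
- move=> n; have [w [Pw qw ew]] := Papp _ (inv0 n).
  exists w; split=> //; rewrite lerD//.
  have := psdD_le2 pq (iota w - x) x; rewrite subrK => /le_trans; apply.
  rewrite lerD2r -[leRHS]mulr1 ler_pM2l//; apply: (le_trans qw).
  by rewrite invf_le1 ?ltr0n// ler1n.
exists l; split.
- by apply: (Plim w) => // n; have [] := Kw n.
- apply/le_anti; rewrite (psd_ge0 pq) andbT; apply/ler_addgt0Pr => eps e0; rewrite add0r.
  have e4 : 0 < eps / 4 by lra.
  have [N NP] := wl _ e4; have [M _ MP] := near_infty_natSinv_lt (PosNum e4).
  set n := maxn N M; have [_ qn _] := Kw n.
  have h1 := NP n (leq_maxl _ _); have /= h2 := MP n (leq_maxr _ _).
  have := psdD_le2 pq (iota l - iota (w n)) (iota (w n) - x); rewrite addrA subrK.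
  have h3 := le_lt_trans (form1_ge_q (w n - l)) h1.
  have h4 := le_lt_trans qn h2.
  rewrite linearB/= (psdBC pq) in h3; move: h3 h4.
  by lra.
- apply: (psd_limit_le pe) => eps e0; have [N NP] := wl _ e0.
  exists (w N); have [_ _ ew] := Kw N; split=> //.
  exact: le_lt_trans (form1_ge_e _) (NP N (leqnn _)).
Qed.

Lemma resolvent_exists (f : V) : exists w, forall v, form1 w v = q f (iota v).
Proof.
apply: (riesz p1 complete1 (C := q f f)) => [a u v|v].
  by rewrite linearP (formDr bq) (formZr bq).
apply: (le_trans (cauchy_schwarz pq _ _)); rewrite ler_wpM2l ?(psd_ge0 pq)//.
exact: form1_ge_q.
Qed.

(** The chosen solutions are unique only up to null vectors, so this map need not be linear.
    Expressions such as [q f (T g)] are nevertheless bilinear, as [T] can be moved to the other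
    argument. *)
Definition resolvent : V -> W := projT1 (choice resolvent_exists).
Definition resolventV (f : V) : V := iota (resolvent f).

Lemma resolventE f v : form1 (resolvent f) v = q f (iota v).
Proof. exact: (projT2 (choice resolvent_exists) f v). Qed.

Local Notation S := resolvent.
Local Notation T := resolventV.

Lemma resolvent_spectral : spectral_form T q.
Proof.
split=> // [f g|f|f].
- by rewrite (formC bq) -resolventE (formC b1) resolventE.
- by rewrite -resolventE (psd_ge0 p1).
- have h : q f (T f) = form1 (S f) (S f) by rewrite resolventE.
  have := form1_ge_q (S f); rewrite -h => h'.
  have := psd_ge0 pq (f - T f); rewrite !(formE bq) (formC bq (T f) f) -/(T f) in h' *.
  lra.
Qed.

(* The squared norm [q f (T f)] decreases along a solution; unlike [q f f] it is
   differentiated by testing the equation against elements of the domain only. *)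
Theorem heat_unique (w : R -> V) (om : R -> W) :
  q (w 0) (w 0) = 0 ->
  (forall t : R, 0 <= t -> forall eps : R, 0 < eps -> exists eta : R, 0 < eta /\
     forall s, 0 <= s -> `|s - t| < eta -> q (w s - w t) (w s - w t) < eps) ->
  (forall t : R, 0 < t -> w t = iota (om t)) ->
  (forall v (t : R), 0 < t ->
     is_derive t (1 : R) (fun s => q (w s) (iota v)) (- e (om t) v)) ->
  forall t : R, 0 < t -> q (w t) (w t) = 0.
Proof.
move=> w0 wc wom wder.
have sq := resolvent_spectral.
pose B := mulT T q; pose C := mulCT T q.
have sB : spectral_form T B := spectral_mulT sq.
have sC : spectral_form T C := spectral_mulCT sq.
have pB := spectral_psd sB; have pC := spectral_psd sC.
have B_le f : B f f <= q f f by have [_ _ _ h] := sq; exact: h.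
have C_le f : C f f <= q f f by have [_ _ h _] := sq; have := h f; rewrite /C /mulCT; lra.
have C_norm f g : `|C f g| <= nq f * nq g.
  apply: le_trans (psd_norm_le pC _ _) _.
  by apply: ler_pM; rewrite ?sqrtr_ge0// ler_sqrt ?(psd_ge0 pq).
(* Testing the equation against [S g] is possible for every [g], and [e (om c) (S g)] equals
   [C (w c) g] by the definition of the resolvent. *)
have incr (a b : R) g : 0 < a -> a < b -> exists c, a < c /\ c < b /\
    q (w b) (T g) - q (w a) (T g) = - C (w c) g * (b - a).
  move=> a0 ab; pose p s := q (w s) (T g).
  have der (c : R) : 0 < c -> is_derive c (1 : R) p (- C (w c) g).
    move=> c0; have -> : C (w c) g = e (om c) (S g).
      have := resolventE g (om c); rewrite (formC b1) /form1 (formC bq g) -wom//.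
      rewrite /C /mulCT /resolventV; lra.
    exact: wder.
  have [||c] := @MVT R p (fun c => - C (w c) g) a b ab.
  - by move=> x; rewrite in_itv/= => /andP[ax _]; apply: der; exact: lt_trans ax.
  - apply: derivable_within_continuous => x; rewrite in_itv/= => /andP[ax _].
    exact: (@ex_derive _ _ _ _ _ _ _ (der x (lt_le_trans a0 ax))).
  - by rewrite in_itv/= => /andP[ac cb] eq; exists c.
pose N s := B (w s) (w s).
have Nder (t : R) : 0 < t -> is_derive t (1 : R) N (- (2 * C (w t) (w t))).
  move=> t0; apply: is_derive_eps => eps e0.
  (* [r * K] will bound [C (w t) y + 2 * C x (w t) + C x y] when [x] and [y] have norm at most
     [r <= 1]. *)
  pose K := 3 * nq (w t) + 1; have K0 : 0 < K by have := sqrtr_ge0 (q (w t) (w t)); rewrite /K; lra.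
  pose r := Num.min 1 (eps / K); have r0 : 0 < r by rewrite lt_min ltr01 divr_gt0.
  have r1 : r <= 1 by rewrite ge_min lexx.
  have rK : r * K <= eps by rewrite -ler_pdivlMr// ge_min lexx orbT.
  have [eta [eta0 etaP]] := wc t (ltW t0) _ (exprn_gt0 2 r0).
  have near_r (s : R) : 0 <= s -> `|s - t| < eta -> nq (w s - w t) <= r.
    move=> s0 st; rewrite -(ger0_norm (ltW r0)) -sqrtr_sqr ler_sqrt ?sqr_ge0//.
    by apply: ltW; exact: etaP.
  exists (Num.min eta t); split; first by rewrite lt_min eta0.
  move=> h h0; rewrite lt_min => /andP[h_eta h_t].
  have th0 : 0 < t + h by move: h_t; rewrite ltr_norml => /andP[? _]; lra.
  (* By symmetry of [B] the increment of [N] is [B (w (t + h) - w t) g]. The vector [g] depends on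
     [h] but not on the running time, so [incr] applies to it. *)
  set g := w (t + h) + w t.
  have Ndiff : N (t + h) - N t = q (w (t + h)) (T g) - q (w t) (T g).
    have [bB _ _ _] := sB.
    have -> : q (w (t + h)) (T g) - q (w t) (T g) = B (w (t + h)) g - B (w t) g by [].
    by rewrite /N /g !(formDr bB) (formC bB (w t) (w (t + h))); ring.
  have [c [c0 [ct Nc]]] : exists c, 0 <= c /\ `|c - t| < eta /\
      N (t + h) - N t = - C (w c) g * h.
    have [hpos|hneg|h00] := ltgtP 0 h; last by rewrite h00 eqxx in h0.
      have [c [tc [cth eq]]] := incr t (t + h) g t0 (ltac:(by rewrite ltrDl)).
      exists c; split; first by rewrite ltW// (lt_trans t0).
      rewrite Ndiff eq [t + h]addrC addrK; split => //.
      rewrite ger0_norm; last by rewrite subr_ge0 ltW.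
      by apply: le_lt_trans h_eta; rewrite ger0_norm ?ltW//; lra.
    have [c [tc [cth eq]]] := incr (t + h) t g th0 (ltac:(by rewrite gtrDl)).
    exists c; split; first by rewrite ltW// (lt_trans th0).
    split; last by rewrite Ndiff -[LHS]opprK opprB eq; ring.
    rewrite ltr0_norm; last by rewrite subr_lt0.
    by apply: le_lt_trans h_eta; rewrite ltr0_norm//; lra.
  rewrite Nc; have -> : - C (w c) g * h - h * - (2 * C (w t) (w t)) =
    - (C (w c) g - 2 * C (w t) (w t)) * h by ring.
  rewrite normrM normrN ler_wpM2r//.
  have [bC _ _ _] := sC.
  pose x := w c - w t; pose y := w (t + h) - w t.
  have nx : nq x <= r by exact: near_r.
  have ny : nq y <= r by apply: near_r; [exact: ltW|rewrite [t + h]addrC addrK].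
  have -> : C (w c) g - 2 * C (w t) (w t) = C (w t) y + 2 * C x (w t) + C x y.
    by rewrite /g /x /y !(formE bC) (formC bC (w c) (w t)); ring.
  have nt := sqrtr_ge0 (q (w t) (w t)).
  have n1 : `|C (w t) y| <= nq (w t) * r by apply: le_trans (C_norm _ _) _; rewrite ler_wpM2l.
  have n2 : `|C x (w t)| <= r * nq (w t) by apply: le_trans (C_norm _ _) _; rewrite ler_wpM2r.
  have n3 : `|C x y| <= r.
    apply: le_trans (C_norm _ _) _; rewrite -[leRHS]mulr1 ler_pM ?sqrtr_ge0//.
    exact: le_trans r1.
  apply: le_trans rK; apply: le_trans (ler_normD _ _) _.
  have := ler_normD (C (w t) y) (2 * C x (w t)); rewrite normrM [`|2|]ger0_norm//.
  by rewrite /K; move: n1 n2 n3; lra.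
move=> t t0.
have N0 : N 0 = 0.
  by have := B_le (w 0); rewrite w0 => h; apply/le_anti; rewrite h (psd_ge0 pB).
have Ncont (s : R) : 0 < s -> N x @[x --> s] --> N s.
  move=> s0; apply: differentiable_continuous; apply/derivable1_diffP.
  exact: (@ex_derive _ _ _ _ _ _ _ (Nder s s0)).
have Nle : N t <= N 0.
  apply: (@ler0_derive1_nincr _ N 0 t) => //; [| | |exact: ltW].
  - move=> x; rewrite in_itv/= => /andP[x0 _].
    exact: (@ex_derive _ _ _ _ _ _ _ (Nder x x0)).
  - move=> x; rewrite in_itv/= => /andP[x0 _]; rewrite derive1E.
    rewrite (@derive_val _ _ _ _ _ _ _ (Nder x x0)).
    by rewrite oppr_le0 mulr_ge0// (psd_ge0 pC).
  - apply/continuous_within_itvP => //; split.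
    + by move=> x; rewrite in_itv/= => /andP[x0 _]; exact: Ncont.
    + apply/cvgrPdist_le => eps e0; have [eta [eta0 etaP]] := wc 0 (lexx _) _ e0.
      exists eta => // s; rewrite /ball_ /= sub0r normrN => s_eta s0.
      rewrite N0 sub0r normrN ger0_norm ?(psd_ge0 pB)//; apply: le_trans (B_le _) _.
      have := etaP s (ltW s0); rewrite subr0 => /(_ s_eta).
      rewrite !(formE bq) (psd_null_r pq _ w0) (psd_null_l pq _ w0) w0; lra.
    + by apply: cvg_at_left_filter; exact: Ncont.
(* [N t = 0] makes [S (w t)] a null vector of [form1]; as [w t] comes from the domain, [q (w t) (w
   t) = form1 (S (w t)) (om t) = 0]. *)
have Nt0 : form1 (S (w t)) (S (w t)) = 0.
  by rewrite resolventE; apply/le_anti; rewrite -[q _ _]/(N t) -{1}N0 Nle (psd_ge0 pB).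
by rewrite {2}(wom t t0) -resolventE (psd_null_l p1).
Qed.

Hypothesis dense : forall (f : V) (eps : R), 0 < eps ->
  exists w, q (f - iota w) (f - iota w) < eps.

(* [alpha (alpha + A)^-1 w --> w] as [alpha --> +oo], where [A] is the generator,
   and [(alpha + A)^-1] has the same range as [(1 + A)^-1]. *)
Lemma resolvent_dense (f : V) (eps : R) : 0 < eps ->
  exists g, q (f - T g) (f - T g) < eps.
Proof.
move=> e0; have e4 : 0 < eps / 4 by lra.
have [w hw] := dense f e4.
have ew0 := psd_ge0 pe w.
(* Chosen so that [al * (eps / 4) >= e w w / 4]; the summand 1 lets [b] dominate [form1]. *)
pose al := 1 + e w w / eps; have al1 : 1 <= al by rewrite lerDl divr_ge0// ltW.
have al0 : 0 < al by lra.
pose b (x y : W) := e x y + al * q (iota x) (iota y).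
have pb : psd_form b.
  split=> [|x]; last by rewrite addr_ge0 ?mulr_ge0 ?(psd_ge0 pe) ?(psd_ge0 pq)// ltW.
  split=> [x y|a x y v]; rewrite /b; first by rewrite (formC be) (formC bq).
  by rewrite linearP !(formE be) !(formE bq); ring.
have b_ge x : form1 x x <= b x x.
  by rewrite lerD2l ler_peMl// psd_ge0.
have b_le x : b x x <= al * form1 x x.
  by rewrite mulrDr lerD2r ler_peMl// psd_ge0.
have cb : form_complete b.
  move=> u uP; have [l lP] : exists l, forall eps : R, 0 < eps ->
      exists N, forall n, (N <= n)%N -> form1 (u n - l) (u n - l) < eps.
    apply: complete1 => x x0; have [N NP] := uP _ x0; exists N => n k nN kN.
    exact: le_lt_trans (b_ge _) (NP _ _ nN kN).
  exists l => x x0; have [N NP] := lP _ (divr_gt0 x0 al0); exists N => n nN.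
  by apply: le_lt_trans (b_le _) _; rewrite mulrC -ltr_pdivlMr//; exact: NP.
have [z zP] : exists z, forall v, b z v = al * q (iota w) (iota v).
  apply: (riesz pb cb (C := al * q (iota w) (iota w))) => [a x y|v].
    by rewrite linearP (formDr bq) (formZr bq); ring.
  rewrite exprMn; apply: (@le_trans _ _ (al ^+ 2 * (q (iota w) (iota w) * q (iota v) (iota v)))).
    by rewrite ler_wpM2l ?sqr_ge0// cauchy_schwarz.
  have -> : al ^+ 2 * (q (iota w) (iota w) * q (iota v) (iota v)) =
     al * q (iota w) (iota w) * (al * q (iota v) (iota v)) by ring.
  by rewrite ler_wpM2l ?mulr_ge0 ?(psd_ge0 pq) ?(ltW al0)// lerDr psd_ge0.
(* From [(al + A) z = al w] one gets [A z = al (w - z)], so this is [(1 + A) z]. *)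
pose g := iota z + al *: (iota w - iota z).
have zS v : form1 (z - S g) v = 0.
  rewrite (formBl b1) resolventE /g /form1 !(formE bq).
  by have := zP v; rewrite /b; lra.
have zT : q (iota z - T g) (iota z - T g) = 0.
  apply/le_anti; rewrite (psd_ge0 pq) andbT.
  by have := form1_ge_q (z - S g); rewrite zS linearB.
exists g.
(* With [y = w - z], the equation for [z] gives [al * q y y = e (w - y) y], and positivity of [e] at
   [w - 2 y] bounds this by [e w w / 4]. *)
have y_le : al * q (iota w - iota z) (iota w - iota z) <= e w w / 4.
  have := zP (w - z); rewrite /b linearB/= !(formE bq) !(formE be).
  have := psd_ge0 pe (w - 2 *: (w - z)).
  rewrite !(formE be) (formC be z w) (formC bq (iota z) (iota w)); lra.
have y_lt : q (iota w - iota z) (iota w - iota z) <= eps / 4.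
  rewrite -(ler_pM2l al0); apply: (le_trans y_le).
  have -> : al * (eps / 4) = eps / 4 + e w w / 4 by rewrite /al; field; rewrite gt_eqF.
  lra.
have -> : f - T g = (f - iota w) + ((iota w - iota z) + (iota z - T g)).
  by rewrite !addrA subrK subrK.
apply: le_lt_trans (psdD_le2 pq _ _) _.
have -> : q (iota w - iota z + (iota z - T g)) (iota w - iota z + (iota z - T g))
   = q (iota w - iota z) (iota w - iota z).
  move: zT; move: (iota z - T g) (iota w - iota z) => x y x0.
  by rewrite !(formE bq) (psd_null_r pq _ x0) (psd_null_l pq _ x0) x0; ring.
lra.
Qed.

(** Formally [form1] is [q] divided by [T], so the element of the domain representing [heat_div t]
    of [T] for [form1] represents [heat_mul t] of [T] for [q]. Taking it from [riesz] puts [u t] in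
    the domain; the estimates uniform in [x] then give its behaviour in time. *)
Theorem heat_exists (f : V) : exists u : R -> W,
  [/\ (forall v (t : R), 0 < t ->
         is_derive t (1 : R) (fun s => q (iota (u s)) (iota v)) (- e (u t) v)),
      (forall t : R, 0 < t -> forall eps : R, 0 < eps -> exists eta : R, 0 < eta /\
         forall s, 0 < s -> `|s - t| < eta ->
           q (iota (u s) - iota (u t)) (iota (u s) - iota (u t)) < eps) &
      (forall eps : R, 0 < eps -> exists eta : R, 0 < eta /\
         forall s, 0 < s -> s < eta -> q (iota (u s) - f) (iota (u s) - f) < eps)].
Proof.
have [U [UU Uoo]] := ultraFilterLemma (@eventually_filter : ProperFilter \oo).
have sq := resolvent_spectral.
pose L := calculus T q U.
have Ldiv (t : R) : 0 < t -> bounded01 (heat_div t).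
  by move=> t0; exact/lipschitz_bounded/heat_div_lipschitz.
have Lmul (t : R) : 0 < t -> bounded01 (heat_mul t).
  by move=> t0; exact/lipschitz_bounded/heat_mul_lipschitz.
have LT phi x y : lipschitz01 phi -> L phi x (T y) = L (fun r => r * phi r) x y.
  move=> lphi; have lx := lipschitzM (@lipschitz_id R) lphi.
  by apply: calculus_mulT => //; [exact: lipschitz_unif..|exact: lipschitz_bounded].
have bL phi : bounded01 phi -> sym_bilinear (L phi) by move=> ?; exact: calculus_bilinear.
have /choice[u uP] : forall t : R, exists w, 0 < t -> forall v, form1 w v = L (heat_div t) f (iota v).
  move=> t; have [t0|t0] := ltP 0 t; last by exists 0.
  have [M MP] := Ldiv t t0; have bl := bL _ (Ldiv t t0).
  have [|v|w wP] := riesz (l := fun v => L (heat_div t) f (iota v)) (C := M ^+ 2 * q f f) p1 complete1.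
  - by move=> a x y; rewrite linearP (formDr bl) (formZr bl).
  - have := calculus_bound sq UU f (iota v) MP; rewrite -/L => h.
    have := ler_pM (normr_ge0 _) (normr_ge0 _) h h; rewrite -expr2 real_normK ?num_real//.
    move=> /le_trans; apply; rewrite -expr2 !exprMn !sqr_sqrtr ?(psd_ge0 pq)// mulrA.
    by apply: ler_wpM2l; [rewrite mulr_ge0 ?(psd_ge0 pq)//; exact: sqr_ge0 | exact: form1_ge_q].
  by exists w => _ v; exact: wP.
have qu (t : R) g : 0 < t -> q (iota (u t)) g = L (heat_mul t) f g.
  move=> t0; rewrite (formC bq) -resolventE (formC b1) uP//; apply: LT.
  exact: heat_div_lipschitz.
have eu (t : R) v : 0 < t -> e (u t) v = L (heat_div t) f (iota v) - L (heat_mul t) f (iota v).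
  by move=> t0; rewrite -uP// -qu// /form1 addrK.
have taylor (s t : R) g : 0 < s -> 0 < t -> `|s - t| <= t / 2 ->
   `|L (heat_mul s) f g - L (heat_mul t) f g
      + (s - t) * (L (heat_div t) f g - L (heat_mul t) f g)|
     <= 8 / t ^+ 2 * (s - t) ^+ 2 * (nq f * nq g).
  move=> s0 t0 st.
  have bD (a : R) (phi psi : R -> R) : bounded01 phi -> bounded01 psi -> bounded01 (fun x => a * phi x + psi x).
    move=> [M MP] [N NP]; exists (`|a| * M + N) => x x01; apply: le_trans (ler_normD _ _) _.
    by rewrite lerD ?NP// normrM ler_wpM2l// MP.
  have b0 : bounded01 (fun=> 0 : R) by exists 0 => x _; rewrite normr0.
  have bm := Lmul t t0; have bs := Lmul s s0; have bd := Ldiv t t0.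
  have c1 := bD (- (s - t)) _ _ bm b0.
  have c2 := bD (s - t) _ _ bd c1.
  have c3 := bD (-1) _ _ bm c2.
  have := @calculus_bound _ _ _ _ sq U UU (fun x => 1 * heat_mul s x + ((-1) * heat_mul t x +
       ((s - t) * heat_div t x + (- (s - t) * heat_mul t x + 0))))
       (8 / t ^+ 2 * (s - t) ^+ 2) f g.
  rewrite !calculus_linear// calculus_cst -/L => h.
  apply: le_trans (h _); first by rewrite le_eqVlt; apply/orP; left; apply/eqP; congr `|_|; ring.
  move=> x x01; apply: le_trans (heat_mul_taylor t0 st x01).
  by rewrite le_eqVlt; apply/orP; left; apply/eqP; congr `|_|; ring.
exists u; split.
- move=> v t t0; apply: is_derive_eps => eps e0.
  set C := 8 / t ^+ 2 * (nq f * nq (iota v)).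
  have C0 : 0 <= C.
    by apply: mulr_ge0; [apply: divr_ge0; rewrite // sqr_ge0 | apply: mulr_ge0; exact: sqrtr_ge0].
  have C1 : 0 < C + 1 by lra.
  have t2 : 0 < t / 2 by lra.
  exists (Num.min (t / 2) (eps / (C + 1))); split.
    by rewrite lt_min t2 divr_gt0.
  move=> h h0; rewrite lt_min => /andP[/ltW ht he].
  have s0 : 0 < t + h by move: ht; rewrite ler_norml => /andP[? _]; lra.
  have := taylor (t + h) t (iota v) s0 t0.
  have -> : t + h - t = h by rewrite addrC addKr.
  move=> /(_ ht); rewrite -eu// -!qu// mulrN opprK => /le_trans; apply.
  have -> : 8 / t ^+ 2 * h ^+ 2 * (nq f * nq (iota v)) = C * `|h| * `|h|.
    rewrite -[RHS]mulrA -[`|h| * _]/(`|h| ^+ 2) real_normK ?num_real// /C; ring.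
  rewrite ler_wpM2r//; apply: (@le_trans _ _ ((C + 1) * `|h|)).
    by rewrite ler_wpM2r//; lra.
  by rewrite mulrC -ler_pdivlMr// ltW.
- move=> t t0 eps e0; have [M1 M1P] := Ldiv t t0; have [M2 M2P] := Lmul t t0.
  have o01 : 0 <= (0 : R) <= 1 by rewrite lexx ler01.
  have M10 := le_trans (normr_ge0 _) (M1P _ o01).
  have M20 := le_trans (normr_ge0 _) (M2P _ o01).
  (* [M1 + M2] comes from the linear term of [taylor], and [4 / t] from its remainder, as
     [|s - t| <= t / 2]. The estimate is tested on the difference [d] itself, and one factor [nq d]
     is divided out. *)
  set K := (4 / t + M1 + M2) * nq f.
  have t4 : 0 <= 4 / t by rewrite divr_ge0// ltW.
  have K0 : 0 <= K by rewrite mulr_ge0 ?sqrtr_ge0 ?addr_ge0.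
  have K1 : 0 < K + 1 by lra.
  have t2 : 0 < t / 2 by lra.
  have se : 0 < Num.sqrt eps by rewrite sqrtr_gt0.
  exists (Num.min (t / 2) (Num.sqrt eps / (K + 1))); split.
    by rewrite lt_min t2 divr_gt0.
  move=> s s0; rewrite lt_min => /andP[/ltW ht he]; rewrite -ltr_sqrt//.
  apply: (@le_lt_trans _ _ (K * `|s - t|)); last first.
    apply: (@le_lt_trans _ _ ((K + 1) * `|s - t|)); first by rewrite ler_wpM2r//; lra.
    by rewrite mulrC -ltr_pdivlMr.
  apply: (psd_sqrt_le pq); first by rewrite mulr_ge0.
  set d := iota (u s) - iota (u t).
  have qd : q d d = L (heat_mul s) f d - L (heat_mul t) f d.
    by rewrite {1}/d (formBl bq) !qu.
  rewrite {1}qd.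
  have h1 := taylor s t d s0 t0 ht.
  have h2 := calculus_bound sq UU f d M1P; have h3 := calculus_bound sq UU f d M2P.
  rewrite -/L in h2 h3; set l1 := L (heat_div t) f d in h1 h2.
  set l2 := L (heat_mul t) f d in h1 h3 *; set l3 := L (heat_mul s) f d in h1 *.
  have N0 : 0 <= nq f * nq d by rewrite mulr_ge0 ?sqrtr_ge0.
  have h4 : `|(s - t) * (l1 - l2)| <= `|s - t| * ((M1 + M2) * (nq f * nq d)).
    by rewrite normrM ler_wpM2l// (le_trans (ler_normB _ _))// mulrDl lerD.
  have h5 : 8 / t ^+ 2 * (s - t) ^+ 2 <= 4 / t * `|s - t|.
    rewrite -[(s - t) ^+ 2]real_normK ?num_real// expr2 mulrA ler_wpM2r//.
    have -> : 8 / t ^+ 2 * `|s - t| = (8 / t ^+ 2) * `|s - t| by [].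
    apply: (@le_trans _ _ (8 / t ^+ 2 * (t / 2))).
      by rewrite ler_wpM2l// divr_ge0// sqr_ge0.
    by rewrite le_eqVlt; apply/orP; left; apply/eqP; field; rewrite gt_eqF.
  have h6 := ler_wpM2r N0 h5.
  have h7 := ler_norm (l3 - l2 + (s - t) * (l1 - l2)).
  have := ler_norm (- ((s - t) * (l1 - l2))); rewrite normrN.
  have -> : K * `|s - t| * nq d = 4 / t * `|s - t| * (nq f * nq d) +
      `|s - t| * ((M1 + M2) * (nq f * nq d)) by rewrite /K; ring.
  by move: h1 h4 h6 h7; lra.
- move=> eps e0; have e4 : 0 < eps / 4 by lra.
  have [g gP] := resolvent_dense f e4.
  have se : 0 < Num.sqrt eps by rewrite sqrtr_gt0.
  have g1 : 0 < nq g + 1 by have := sqrtr_ge0 (q g g); lra.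
  exists (Num.sqrt eps / 2 / (nq g + 1)); split; first by rewrite !divr_gt0.
  move=> s s0; rewrite ltr_pdivlMr// => sg; rewrite -ltr_sqrt//.
  set h := iota (u s) - f.
  have nfg : nq (f - T g) < Num.sqrt eps / 2.
    have -> : Num.sqrt eps / 2 = Num.sqrt (eps / 4).
      have -> : eps / 4 = (Num.sqrt eps / 2) ^+ 2.
        by rewrite expr_div_n sqr_sqrtr ?ltW// -natrX.
      by rewrite sqrtr_sqr ger0_norm// divr_ge0// ltW.
    by rewrite ltr_sqrt.
  apply: (@le_lt_trans _ _ (nq (f - T g) + s * nq g)); last first.
    have : s * nq g <= s * (nq g + 1) by rewrite ler_wpM2l ?ltW//; lra.
    by lra.
  apply: (psd_sqrt_le pq).
    by rewrite addr_ge0 ?sqrtr_ge0// mulr_ge0 ?sqrtr_ge0 ?ltW.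
  pose phi x := heat_mul s x - 1.
  have lphi : lipschitz01 phi by exact/lipschitz_sub_cst/heat_mul_lipschitz.
  have bphi := lipschitz_bounded lphi.
  have qh : q h h = L phi f h.
    rewrite {1}/h (formBl bq) qu// /L.
    rewrite (@eq_calculus _ _ T q U phi (fun x => 1 * heat_mul s x + (fun=> -1) x)).
      rewrite calculus_linear//; last by exists 1 => x _; rewrite normrN1.
        by rewrite calculus_cst mul1r mulN1r.
      exact: Lmul.
    by move=> x _; rewrite /phi mul1r.
  (* The first term is small because [phi] is bounded by 1, the second because its [T] turns [phi]
     into [x * phi x], bounded by [s]. *)
  rewrite {1}qh; have -> : L phi f h = L phi (f - T g) h + L phi h (T g).
    by rewrite (formC (bL _ bphi) h) -(formDl (bL _ bphi)) subrK.
  rewrite LT// mulrDl; apply: lerD; apply: le_trans (ler_norm _) _.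
    rewrite -[leRHS]mul1r; apply: calculus_bound => // x; exact: heat_mul_contract.
  rewrite -mulrA [nq g * _]mulrC; apply: calculus_bound => // x; exact: heat_mul_initial.
Qed.

End AbstractForm.

(** * Forms on L^2 *)

Record subspace (R : realType) (V : lmodType R) := Subspace {
  subspace_set :> V -> Prop;
  subspace0 : subspace_set 0;
  subspaceP : forall a u v, subspace_set u -> subspace_set v -> subspace_set (a *: u + v) }.

Section SubspaceType.
Variables (R : realType) (V : lmodType R) (S : subspace V).

Definition subspace_pred : {pred V} := [pred x | `[< S x >]].

Lemma subspace_submod_closed : submod_closed subspace_pred.
Proof.
split=> [|a u v]; first exact/asboolP/subspace0.
by move=> /asboolP Su /asboolP Sv; exact/asboolP/subspaceP.
Qed.

HB.instance Definition _ := GRing.isSubmodClosed.Build R V subspace_pred subspace_submod_closed.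

Definition subspace_type := {x : V | x \in subspace_pred}.

HB.instance Definition _ := SubChoice.on subspace_type.
HB.instance Definition _ := [SubChoice_isSubLmodule of subspace_type by <:].

Lemma subspace_typeP (x : subspace_type) : S (val x).
Proof. exact/asboolP/(valP x). Qed.

Definition to_subspace (x : V) (Sx : S x) : subspace_type := exist _ x (asboolT Sx).

End SubspaceType.

Section L2Space.
Variables (R : realType) (F : pseudoPMetricType R).
Variable m : {measure set (Borel F) -> \bar R}.
Hypothesis mfin : (m [set: Borel F] < +oo)%E.
Implicit Types f g h : F -> R.

Lemma L2_cst (c : R) : L2 m (fun=> c).
Proof.
split; first exact: measurable_cst.
rewrite integral_cst//= lte_mul_pinfty// ?lee_fin ?sqr_ge0//.
Qed.

Lemma L2_mul_integrable f g : L2 m f -> L2 m g ->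
  m.-integrable [set: Borel F] (fun x => (f x * g x)%:E).
Proof.
move=> [mf if_] [mg ig].
have sqr_int h : measurable_fun [set: Borel F] (h : Borel F -> R) ->
    (\int[m]_x ((h x) ^+ 2)%:E < +oo)%E -> m.-integrable [set: Borel F] (fun x => (h x ^+ 2)%:E).
  move=> mh ih; apply/integrableP; split.
    by apply/measurable_EFinP; exact: measurable_funX.
  by under eq_integral do rewrite gee0_abs ?lee_fin ?sqr_ge0//.
have := integrableD measurableT (sqr_int f mf if_) (sqr_int g mg ig).
apply: le_integrable => //.
  by apply/measurable_EFinP; exact: measurable_funM.
move=> x _; rewrite /= lee_fin [leRHS]ger0_norm ?addr_ge0 ?sqr_ge0//.
rewrite ler_norml; apply/andP; split.
  by have := sqr_ge0 (f x + g x); have := sqr_ge0 (f x); have := sqr_ge0 (g x); lra.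
by have := sqr_ge0 (f x - g x); have := sqr_ge0 (f x); have := sqr_ge0 (g x); lra.
Qed.

Lemma L2_lin (a : R) f g : L2 m f -> L2 m g -> L2 m (fun x => a * f x + g x).
Proof.
move=> Lf Lg; have [mf _] := Lf; have [mg _] := Lg; split.
  by apply: measurable_funD => //; apply: measurable_funM.
have i1 := L2_mul_integrable Lf Lf; have i2 := L2_mul_integrable Lf Lg.
have i3 := L2_mul_integrable Lg Lg.
have -> : (\int[m]_x ((a * f x + g x) ^+ 2)%:E =
  \int[m]_x ((a ^+ 2)%:E * (f x * f x)%:E + ((2 * a)%:E * (f x * g x)%:E + (g x * g x)%:E)))%E.
  by apply: eq_integral => x _; rewrite -!EFinM -!EFinD; congr (_%:E); ring.
apply: integrable_lty => //; apply: integrableD => //; first exact: integrableZl.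
by apply: integrableD => //; exact: integrableZl.
Qed.

Lemma L2_mul_indic (A : set F) f : measurable (A : set (Borel F)) -> L2 m f ->
  L2 m (fun x => \1_A x * f x).
Proof.
move=> mA [mf if_]; split; first exact: measurable_funM.
apply: le_lt_trans if_; apply: ge0_le_integral => //.
- by move=> x _; rewrite lee_fin sqr_ge0.
- by apply/measurable_EFinP/measurable_funX; exact: measurable_funM.
- by apply/measurable_EFinP; exact: measurable_funX.
move=> x _; rewrite lee_fin indicE; case: (x \in A); rewrite ?mul1r// mul0r expr0n sqr_ge0//.
Qed.

Lemma ipC f g : ip m f g = ip m g f.
Proof. by rewrite /ip; congr fine; apply: eq_integral => x _; rewrite mulrC. Qed.

Lemma ip_lin (a : R) f g h : L2 m f -> L2 m g -> L2 m h ->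
  ip m (fun x => a * f x + g x) h = a * ip m f h + ip m g h.
Proof.
move=> Lf Lg Lh; have i1 := L2_mul_integrable Lf Lh; have i2 := L2_mul_integrable Lg Lh.
rewrite /ip.
have -> : (\int[m]_x ((a * f x + g x) * h x)%:E =
  \int[m]_x (a%:E * (f x * h x)%:E + (g x * h x)%:E))%E.
  by apply: eq_integral => x _; rewrite -!EFinM -!EFinD; congr (_%:E); ring.
rewrite integralD//; last exact: integrableZl.
rewrite integralZl// fineD ?fin_numM//; first last.
- exact: integrable_fin_num.
- exact: integrable_fin_num.
by rewrite fineM//; exact: integrable_fin_num.
Qed.

Lemma ip_ge0 f : 0 <= ip m f f.
Proof.
by apply: fine_ge0; apply: integral_ge0 => x _; rewrite lee_fin -expr2 sqr_ge0.
Qed.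

Lemma nrm2_le f g : L2 m f -> L2 m g -> (forall x, `|f x| <= `|g x|) -> nrm2 m f <= nrm2 m g.
Proof.
move=> Lf Lg fg; have i1 := L2_mul_integrable Lf Lf; have i2 := L2_mul_integrable Lg Lg.
have [mf _] := Lf; have [mg _] := Lg.
apply: fine_le; [exact: integrable_fin_num|exact: integrable_fin_num|].
apply: ge0_le_integral => //.
- by move=> x _; rewrite lee_fin -expr2 sqr_ge0.
- by apply/measurable_EFinP; exact: measurable_funM.
- by apply/measurable_EFinP; exact: measurable_funM.
move=> x _; rewrite lee_fin -!expr2 -[f x ^+ 2]real_normK ?num_real// -[g x ^+ 2]real_normK ?num_real//.
by rewrite ler_pXn2r ?nnegrE.
Qed.

Lemma aeq_ip f f' g g' : L2 m f -> L2 m f' -> L2 m g -> L2 m g' ->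
  aeq m f f' -> aeq m g g' -> ip m f g = ip m f' g'.
Proof.
move=> Lf Lf' Lg Lg' ff' gg'; rewrite /ip; congr fine; apply: ae_eq_integral => //.
- by have /integrableP[] := L2_mul_integrable Lf Lg.
- by have /integrableP[] := L2_mul_integrable Lf' Lg'.
by move: ff' gg'; apply: filterS2 => x h1 h2 _ /=; rewrite h1// h2.
Qed.

Lemma nrm2_eq0 f : L2 m f -> nrm2 m f = 0 -> aeq m f (fun=> 0).
Proof.
move=> Lf; have i1 := L2_mul_integrable Lf Lf; have [mf _] := Lf.
move=> /eqP; rewrite /nrm2 /ip fine_eq0; last exact: integrable_fin_num.
move=> /eqP h.
have mff : measurable_fun [set: Borel F] (fun x => (f x * f x)%:E).
  by apply/measurable_EFinP; exact: measurable_funM.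
have [h1 _] := ae_eq_integral_abs m measurableT mff.
have : ae_eq m [set: Borel F] (fun x => (f x * f x)%:E) (cst 0%E).
  by apply: h1; rewrite -[RHS]h; apply: eq_integral => x _; rewrite gee0_abs// lee_fin -expr2 sqr_ge0.
apply: filterS => x /= hx _; have [] := hx I.
by move/eqP; rewrite mulf_eq0 orbb => /eqP.
Qed.

Lemma L2_sub f g : L2 m f -> L2 m g -> L2 m (fun x => f x - g x).
Proof.
move=> Lf Lg; have := L2_lin (-1) Lg Lf.
by congr L2; apply/funext => x; rewrite mulN1r addrC.
Qed.

Lemma nrm2_sub_eq0 f g : L2 m f -> L2 m g -> nrm2 m (fun x => f x - g x) = 0 -> aeq m f g.
Proof.
move=> Lf Lg /(nrm2_eq0 (L2_sub Lf Lg)); apply: filterS => x h /h/eqP.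
by rewrite subr_eq0 => /eqP.
Qed.

Lemma aeq_nrm2_sub f g : L2 m f -> L2 m g -> aeq m f g -> nrm2 m (fun x => f x - g x) = 0.
Proof.
move=> Lf Lg fg; have L0 := L2_cst 0.
rewrite /nrm2 (@aeq_ip _ (fun=> 0) _ (fun=> 0)) //; try exact: L2_sub.
- by rewrite /ip; under eq_integral do rewrite mul0r; rewrite integral0.
- by move: fg; apply: filterS => x h /h ->; rewrite subrr.
- by move: fg; apply: filterS => x h /h ->; rewrite subrr.
Qed.

Lemma aeq_sym f g : aeq m f g -> aeq m g f.
Proof. exact: ae_eq_sym. Qed.

Lemma aeq_trans f g h : aeq m f g -> aeq m g h -> aeq m f h.
Proof. exact: ae_eq_trans. Qed.

Lemma nrm2_bounded f (c : R) : L2 m f -> (forall x, `|f x| <= `|c|) ->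
  nrm2 m f <= c ^+ 2 * fine (m [set: Borel F]).
Proof.
move=> Lf fc; apply: le_trans (nrm2_le Lf (L2_cst c) fc) _.
rewrite /nrm2 /ip integral_cst// fineM; [exact: lexx|by []|by rewrite ge0_fin_numE].
Qed.

End L2Space.

Section ConcreteForm.
Variables (R : realType) (F : pseudoPMetricType R).
Variable m : {measure set (Borel F) -> \bar R}.
Variables (D : set (F -> R)) (E : (F -> R) -> (F -> R) -> R).
Hypothesis mfin : (m [set: Borel F] < +oo)%E.
Hypothesis sE : Defs.symmetric_form m D E.

Lemma dom_L2 u : D u -> L2 m u. Proof. by have [[h _ _ _ _] _] := sE; exact: h. Qed.

Lemma dom_lin (a : R) (u v : F -> R) : D u -> D v -> D (fun x => a * u x + v x).
Proof.
have [[_ _ _ [_ DD DZ] _] _] := sE.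
by move=> Du Dv; apply: (DD (fun x => a * u x)) => //; exact: DZ.
Qed.

Lemma dom0 : D (fun=> 0). Proof. by have [[_ _ _ [D0 _ _] _] _] := sE. Qed.

Lemma dom_sub (u v : F -> R) : D u -> D v -> D (fun x => u x - v x).
Proof.
move=> Du Dv; have := dom_lin (-1) Dv Du; congr D.
by apply/funext => x; rewrite mulN1r addrC.
Qed.

Lemma dom_aeq u v : D u -> L2 m v -> aeq m u v -> D v.
Proof. by have [[_ h _ _ _] _] := sE; exact: h. Qed.

Lemma form_aeq u u' v v' : D u -> D u' -> D v -> D v' -> aeq m u u' -> aeq m v v' ->
  E u v = E u' v'.
Proof. by have [[_ _ h _ _] _] := sE; exact: h. Qed.

Lemma form_linl (a : R) u v w : D u -> D v -> D w ->
  E (fun x => a * u x + v x) w = a * E u w + E v w.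
Proof. by have [_ [_ h _]] := sE; exact: h. Qed.

Lemma form_symm u v : D u -> D v -> E u v = E v u.
Proof. by have [_ [h _ _]] := sE; exact: h. Qed.

Lemma form_linr (a : R) u v w : D u -> D v -> D w ->
  E w (fun x => a * u x + v x) = a * E w u + E w v.
Proof.
move=> Du Dv Dw; rewrite form_symm//; last exact: dom_lin.
by rewrite form_linl// !(form_symm Dw).
Qed.

Lemma form_nneg u : D u -> 0 <= E u u.
Proof. by have [_ [_ _ h]] := sE; exact: h. Qed.

Definition L2_subspace : subspace (F -> R : lmodType R) :=
  @Subspace R (F -> R : lmodType R) (L2 m) (L2_cst mfin 0) (fun a u v => @L2_lin R F m a u v).

Definition dom_subspace : subspace (F -> R : lmodType R) :=
  @Subspace R (F -> R : lmodType R) D dom0 dom_lin.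

Local Notation V := (subspace_type L2_subspace).
Local Notation W := (subspace_type dom_subspace).

Lemma L2_typeP (f : V) : L2 m (val f). Proof. exact: (subspace_typeP f). Qed.

Lemma dom_typeP (w : W) : D (val w). Proof. exact: (subspace_typeP w). Qed.

Definition dom_incl (w : W) : V := @to_subspace _ _ L2_subspace (val w) (dom_L2 (dom_typeP w)).

Lemma dom_incl_linear : linear dom_incl.
Proof. by move=> a u v; apply/val_inj. Qed.

HB.instance Definition _ := GRing.isLinear.Build R W V _ dom_incl dom_incl_linear.

Definition L2_form (f g : V) : R := ip m (val f) (val g).
Definition dom_form (u v : W) : R := E (val u) (val v).

Lemma L2_form_psd : psd_form L2_form.
Proof.
split=> [|f]; last exact: ip_ge0.
split=> [f g|a f g h]; first exact: ipC.
rewrite /L2_form linearP.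
exact: (ip_lin a (L2_typeP f) (L2_typeP g) (L2_typeP h)).
Qed.

Lemma dom_form_psd : psd_form dom_form.
Proof.
split=> [|f]; last exact/form_nneg/dom_typeP.
split=> [f g|a f g h]; first by apply: form_symm; exact: dom_typeP.
rewrite /dom_form linearP.
exact: (form_linl a (dom_typeP f) (dom_typeP g) (dom_typeP h)).
Qed.

Lemma dom_form_dense (f : V) (eps : R) : 0 < eps ->
  exists w : W, L2_form (f - dom_incl w) (f - dom_incl w) < eps.
Proof.
have [[_ _ _ _ dense] _] := sE => e0.
have [u [Du ue]] := dense _ (L2_typeP f) _ e0.
by exists (@to_subspace _ _ dom_subspace u Du).
Qed.

Hypothesis cE : closed_form m D E.

Lemma dom_form_complete : form_complete (form1 dom_incl L2_form dom_form).
Proof.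
move=> u uC; have [|w [Dw wP]] := cE (fun n => dom_typeP (u n)); first exact: uC.
by exists (@to_subspace _ _ dom_subspace w Dw).
Qed.

(** The constraint [E h w = 0] is linear and closed by Cauchy-Schwarz, so it survives in [form_lsc].
    It carries orthogonality to L^2 limits of bounded energy; [h = 0] gives plain lower
    semicontinuity. *)
Lemma dirichlet_lsc (h x : F -> R) (C : R) : D h -> L2 m x ->
  (forall eps : R, 0 < eps -> exists w, [/\ D w, E h w = 0,
      nrm2 m (fun y => w y - x y) <= eps & E w w <= C]) ->
  [/\ D x, E h x = 0 & E x x <= C].
Proof.
move=> Dh Lx app.
pose hW := @to_subspace _ _ dom_subspace h Dh; pose xV := @to_subspace _ _ L2_subspace x Lx.
have pe := dom_form_psd; have be := pe.1; have pq := L2_form_psd.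
have [| | |w [Pw qw ew]] := @form_lsc _ _ _ dom_incl _ _ pq pe dom_form_complete
    (fun w => dom_form hW w = 0) xV C.
- by move=> u v hu hv; rewrite (formZr be) (formDr be) hu hv addr0 mulr0.
- move=> w l hw wl; apply/eqP; rewrite -sqrf_eq0; apply/eqP/le_anti; rewrite sqr_ge0 andbT.
  apply/ler_addgt0Pr => eps e0; rewrite add0r.
  have h1 : 0 < dom_form hW hW + 1 by have := psd_ge0 pe hW; lra.
  have [N /(_ N (leqnn _)) hN] := wl _ (divr_gt0 e0 h1).
  have := cauchy_schwarz pe hW (w N - l); rewrite (formBr be) hw sub0r sqrrN => /le_trans; apply.
  apply: (@le_trans _ _ ((dom_form hW hW + 1) * dom_form (w N - l) (w N - l))).
    by rewrite ler_wpM2r ?(psd_ge0 pe)//; lra.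
  rewrite mulrC -ler_pdivlMr//; apply/ltW; apply: le_lt_trans hN.
  by rewrite lerDl (psd_ge0 pq).
- move=> eps /app[w [Dw Ew nw ew]]; by exists (@to_subspace _ _ dom_subspace w Dw).
have Dw := dom_typeP w.
have wx : aeq m (val w) x by apply: nrm2_sub_eq0 => //; exact: dom_L2.
have Dx := dom_aeq Dw Lx wx; split=> //.
- by rewrite -(form_aeq Dh Dh Dw Dx (ae_eq_refl _ _ _) wx).
- by rewrite -(form_aeq Dw Dx Dw Dx wx wx).
Qed.

Lemma heat_solution_exists (f : F -> R) : L2 m f -> exists u, heat_solution m D E f u.
Proof.
move=> Lf; pose fV := @to_subspace _ _ L2_subspace f Lf.
have [u [uder ucont uini]] := @heat_exists _ _ _ dom_incl _ _ L2_form_psd dom_form_psd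
  dom_form_complete dom_form_dense fV.
have Du t : D (val (u t)) by exact: dom_typeP.
(* The abstract flow is meaningful for [t > 0] only, and [f] need not lie in [D]; so [f] itself is
   the value at 0. *)
exists (fun t => if t <= 0 then f else val (u t)); split.
- by rewrite lexx; exact: ae_eq_refl.
- by move=> t _; case: ifP => // _; exact: dom_L2.
- move=> t; rewrite le_eqVlt => /predU1P[<-|t0] eps e0.
    have [eta [eta0 etaP]] := uini _ e0; exists eta; split=> // s s0 sd.
    rewrite lexx; case: ifP => [_|/negbT].
      have -> : (fun x => f x - f x) = (fun=> 0) by apply/funext => x; rewrite subrr.
      by rewrite /nrm2 /ip; under eq_integral do rewrite mul0r; rewrite integral0.
    rewrite -ltNge => s1; move: sd; rewrite subr0 ger0_norm// => sd.
    exact: (etaP s s1 sd).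
  have [eta [eta0 etaP]] := ucont t t0 _ e0; exists (Num.min eta t); split.
    by rewrite lt_min eta0.
  move=> s s0; rewrite lt_min => /andP[s1 s2].
  have sp : 0 < s by move: s2; rewrite ltr_norml => /andP[? _]; lra.
  rewrite (lt_geF sp) (lt_geF t0); exact: etaP.
- by move=> t t0; rewrite (lt_geF t0).
- move=> v Dv t t0; rewrite (lt_geF t0).
  apply: near_eq_is_derive (uder (@to_subspace _ _ dom_subspace v Dv) t t0).
  near=> s; have s0 : 0 < s by near: s; exact: lt_nbhsr.
  by rewrite (lt_geF s0).
Unshelve. all: by end_near. Qed.

Lemma heat_solution_unique (f g : F -> R) u u' : aeq m f g -> L2 m f -> L2 m g ->
  heat_solution m D E f u -> heat_solution m D E g u' -> forall t : R, 0 < t -> aeq m (u t) (u' t).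
Proof.
move=> fg Lf Lg [u0 uL uc uD uder] [u'0 u'L u'c u'D u'der] t t0.
(* A total lift with default 0: the difference of the solutions is known to be in L^2 only for
   [t >= 0] and in [D] only for [t > 0]. *)
pose toV (S : subspace (F -> R : lmodType R)) (f : F -> R) : subspace_type S :=
  if pselect (S f) is left H then @to_subspace _ _ S f H else 0.
have toVE (S : subspace (F -> R : lmodType R)) f' : S f' -> val (toV S f') = f'.
  by rewrite /toV; case: pselect.
pose d t x := u t x - u' t x.
have Ld (s : R) : 0 <= s -> L2 m (d s) by move=> s0; apply: L2_sub; [exact: uL|exact: u'L].
have Dd (s : R) : 0 < s -> D (d s) by move=> s0; apply: dom_sub; [exact: uD|exact: u'D].
have vL (s : R) : 0 <= s -> val (toV L2_subspace (d s)) = d s by move=> s0; exact/toVE/Ld.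
have vD (s : R) : 0 < s -> val (toV dom_subspace (d s)) = d s by move=> s0; exact/toVE/Dd.
pose w s := toV L2_subspace (d s); pose om s := toV dom_subspace (d s).
have w0 : L2_form (w 0) (w 0) = 0.
  rewrite /L2_form vL//; apply: aeq_nrm2_sub => //; [exact: uL|exact: u'L|].
  exact: (aeq_trans u0 (aeq_trans fg (aeq_sym u'0))).
have wc (s : R) : 0 <= s -> forall eps : R, 0 < eps -> exists eta : R, 0 < eta /\
    forall r, 0 <= r -> `|r - s| < eta -> L2_form (w r - w s) (w r - w s) < eps.
  move=> s0 eps e0; have e4 : 0 < eps / 4 by lra.
  have [e1 [e10 e1P]] := uc s s0 _ e4; have [e2 [e20 e2P]] := u'c s s0 _ e4.
  exists (Num.min e1 e2); split; first by rewrite lt_min e10.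
  move=> r r0; rewrite lt_min => /andP[r1 r2].
  have h1 := e1P r r0 r1; have h2 := e2P r r0 r2.
  pose x := toV L2_subspace (u r) - toV L2_subspace (u s).
  pose y := toV L2_subspace (u' r) - toV L2_subspace (u' s).
  have wE (v : R) : 0 <= v -> w v = toV L2_subspace (u v) - toV L2_subspace (u' v).
    move=> v0; apply/val_inj; rewrite vL//.
    have -> : val (toV L2_subspace (u v) - toV L2_subspace (u' v)) =
      val (toV L2_subspace (u v)) - val (toV L2_subspace (u' v)) by [].
    by rewrite !toVE//; [exact: u'L|exact: uL].
  have -> : w r - w s = x + (- y).
    by rewrite !wE// /x /y !opprB addrACA [RHS]addrACA; congr (_ + _); rewrite addrC.
  have xE : val x = (fun z => u r z - u s z).
    have -> : val x = val (toV L2_subspace (u r)) - val (toV L2_subspace (u s)) by [].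
    by rewrite !toVE//; exact: uL.
  have yE : val y = (fun z => u' r z - u' s z).
    have -> : val y = val (toV L2_subspace (u' r)) - val (toV L2_subspace (u' s)) by [].
    by rewrite !toVE//; exact: u'L.
  have pq := L2_form_psd; have bq := pq.1.
  apply: le_lt_trans (psdD_le2 pq _ _) _; rewrite (formNl bq) (formNr bq) opprK.
  rewrite /L2_form xE yE; move: h1 h2; rewrite /nrm2; lra.
have wom (s : R) : 0 < s -> w s = dom_incl (om s).
  by move=> s0; apply/val_inj; rewrite vL ?ltW//= vD.
have wder (v : W) (s : R) : 0 < s ->
    is_derive s (1 : R) (fun r => L2_form (w r) (dom_incl v)) (- dom_form (om s) v).
  move=> s0; have Dv := dom_typeP v.
  apply: (@near_eq_is_derive _ _ _ (fun r => ip m (u r) (val v) - ip m (u' r) (val v))).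
    near=> r; have r0 : 0 < r by near: r; exact: lt_nbhsr.
    rewrite /L2_form vL ?ltW//; have Lu := uL r (ltW r0); have Lu' := u'L r (ltW r0).
    have -> : d r = (fun x => (-1) * u' r x + u r x).
      by apply/funext => x; rewrite /d mulN1r addrC.
    by rewrite ip_lin ?mulN1r 1?addrC//; exact: dom_L2.
  have := is_deriveB (uder (val v) Dv s s0) (u'der (val v) Dv s s0).
  congr is_derive; rewrite /dom_form vD//.
  have -> : d s = (fun x => (-1) * u' s x + u s x).
    by apply/funext => x; rewrite /d mulN1r addrC.
  by rewrite form_linl//; [ring|exact: u'D|exact: uD].
have := heat_unique L2_form_psd dom_form_psd dom_form_complete w0 wc wom wder t0.
rewrite /L2_form vL ?ltW// => h.
by apply: nrm2_sub_eq0 => //; [apply: uL|apply: u'L]; exact: ltW.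
Unshelve. all: by end_near. Qed.

End ConcreteForm.

(** * The Markov property *)

Section FormAlgebra.
Variables (R : realType) (F : pseudoPMetricType R).
Variable m : {measure set (Borel F) -> \bar R}.
Variables (D : set (F -> R)) (E : (F -> R) -> (F -> R) -> R).
Hypothesis mfin : (m [set: Borel F] < +oo)%E.
Hypothesis sE : Defs.symmetric_form m D E.

Lemma form_sqr (a : R) u v : D u -> D v ->
  E (fun x => a * u x + v x) (fun x => a * u x + v x)
  = a ^+ 2 * E u u + 2 * a * E u v + E v v.
Proof.
move=> Du Dv; have Dw := dom_lin sE a Du Dv.
rewrite (form_linl sE)// !(form_linr sE)// (form_symm sE Dv Du); ring.
Qed.

Lemma form_zero v : D v -> E (fun=> 0) v = 0.
Proof.
move=> Dv; have D0 := dom0 sE; have := form_linl sE (-1) D0 D0 Dv.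
have -> : (fun x : F => (-1) * 0 + 0) = (fun=> 0 : R) by apply/funext => x; rewrite mulr0 addr0.
by rewrite mulN1r addNr.
Qed.

Lemma form_null u v : D u -> D v -> E u u = 0 -> E u v = 0.
Proof.
move=> Du Dv uu.
exact: (@psd_null_l _ _ _ (dom_form_psd sE) (@to_subspace _ _ (dom_subspace sE) u Du)
  (@to_subspace _ _ (dom_subspace sE) v Dv) uu).
Qed.

Lemma form_sqr_null (a : R) u n : D u -> D n -> E u n = 0 -> E n n = 0 ->
  E (fun x => a * u x + n x) (fun x => a * u x + n x) = a ^+ 2 * E u u.
Proof. by move=> Du Dn un nn; rewrite form_sqr// un nn mulr0 !addr0. Qed.

(** Young's inequality with weight [s], where [s * E f f <= eta / 2] leaves [eta / 2] for
    [(1 + s^-1) * E d d]. As [eps] depends on [f] and [eta] only, approximants can be chosen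
    afterwards. *)
Lemma form_near_le f (eta : R) : D f -> 0 < eta -> exists eps : R, 0 < eps /\
  forall g, D g -> E (fun x => f x - g x) (fun x => f x - g x) < eps -> E g g <= E f f + eta.
Proof.
move=> Df eta0; have f0 := form_nneg sE Df.
pose s := eta / (2 * (E f f + 1)).
have d0 : 0 < 2 * (E f f + 1) by lra.
have s0 : 0 < s by rewrite divr_gt0.
have i0 : 0 < s^-1 by rewrite invr_gt0.
have s1 : 0 < 1 + s^-1 by lra.
exists (eta / 2 / (1 + s^-1)); split; first by rewrite !divr_gt0.
move=> g Dg; pose d x := f x - g x; have Dd : D d := dom_sub sE Df Dg.
rewrite -/d ltr_pdivlMr// mulrDr mulr1 => dlt.
have gE : g = (fun x => (-1) * d x + f x) by apply/funext => x; rewrite /d; ring.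
have -> : E g g = (-1) ^+ 2 * E d d + 2 * (-1) * E d f + E f f by rewrite {1 2}gE form_sqr.
have := form_nneg sE (dom_lin sE s Df Dd); rewrite form_sqr// (form_symm sE Df Dd) => h.
have h2 : - (2 * E d f) <= s * E f f + E d d / s.
  rewrite -(ler_pM2l s0); have -> : s * (s * E f f + E d d / s) = s ^+ 2 * E f f + E d d by field; rewrite gt_eqF.
  lra.
have h3 : s * E f f <= eta / 2.
  have -> : s * E f f = (eta / 2) * (E f f / (E f f + 1)) by rewrite /s; field; rewrite !gt_eqF//; lra.
  by rewrite ler_piMr ?ler_pdivrMr//; lra.
lra.
Qed.

Definition trunc01 (u : F -> R) : F -> R := fun x => Num.min (Num.max 0 (u x)) 1.

Lemma trunc01_id u x : 0 <= u x <= 1 -> trunc01 u x = u x.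
Proof. by move=> /andP[h0 h1]; rewrite /trunc01 (max_r h0) (min_l h1). Qed.

Lemma trunc01_lo u x : u x <= 0 -> trunc01 u x = 0.
Proof. by move=> h; rewrite /trunc01 (max_l h) min_l. Qed.

Lemma trunc01_hi u x : 1 <= u x -> trunc01 u x = 1.
Proof. by move=> h; rewrite /trunc01 max_r ?(le_trans ler01)// min_r. Qed.

Lemma trunc01_dist u v x : `|trunc01 u x - trunc01 v x| <= `|u x - v x|.
Proof.
have h1 := ler_norm (u x - v x); have h2 := ler_norm (v x - u x); rewrite distrC in h2.
have tri (w : F -> R) : [\/ w x <= 0 /\ trunc01 w x = 0, 1 <= w x /\ trunc01 w x = 1 |
    0 <= w x <= 1 /\ trunc01 w x = w x].
  have [w0|w0] := leP (w x) 0; first by constructor 1; rewrite trunc01_lo.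
  have [w1|w1] := leP (w x) 1; last by constructor 2; rewrite trunc01_hi ltW.
  have w01 : 0 <= w x <= 1 by rewrite (ltW w0) w1.
  by constructor 3; rewrite (ltW w0); split; [|exact: trunc01_id].
rewrite ler_norml; apply/andP.
by case: (tri u) => -[? ->]; case: (tri v) => -[? ->]; split; lra.
Qed.

Definition pos_part (u : F -> R) : F -> R := fun x => Num.max 0 (u x).

Lemma pos_part_trunc (u : F -> R) (M : R) : 0 < M -> (forall x, `|u x| <= M) ->
  pos_part u = (fun x => M * trunc01 (fun y => M^-1 * u y) x).
Proof.
move=> M0 uM; apply/funext => x; rewrite /pos_part /trunc01.
have := uM x; rewrite ler_norml => /andP[_ ux].
have e : Num.max 0 (M^-1 * u x) = M^-1 * Num.max 0 (u x).
  by rewrite maxr_pMr ?mulr0// invr_ge0 ltW.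
rewrite e min_l; first by rewrite mulrA mulfV ?mul1r// gt_eqF.
by rewrite mulrC ler_pdivrMr// mul1r ge_max ux ltW.
Qed.

Lemma continuous_bounded (u : F -> R) : compact [set: F] -> continuous u ->
  exists M : R, 0 < M /\ forall x, `|u x| <= M.
Proof.
move=> cF cu; have := @continuous_compact _ _ u [set: F].
move=> /(_ (continuous_subspaceT cu) cF)/compact_bounded[M [_ MP]].
exists (`|M| + 1); split; first by have := normr_ge0 M; lra.
move=> x; apply: (MP (`|M| + 1)); first by have := ler_norm M; lra.
by exists x.
Qed.

Lemma supp_closed (u : F -> R) : closed (supp m u).
Proof.
have -> : supp m u = ~` (\bigcup_(U in [set U | open U /\ ~ (0 < m (U `&` [set y | u y != 0%R]))%E]) U).
  apply/seteqP; split => x /=; first by move=> h [U [oU nU] Ux]; apply: nU; exact: h.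
  move=> h U oU Ux; apply: contrapT => nU; apply: h; by exists U.
by apply: open_closedC; apply: bigcup_open => U [].
Qed.

Lemma supp_compact (u : F -> R) : compact [set: F] -> compact (supp m u).
Proof. by move=> cF; apply: subclosed_compact cF _ => //; exact: supp_closed. Qed.

Lemma supp_open0 (u : F -> R) (U : set F) x : open U -> U x -> (forall y, U y -> u y = 0) ->
  ~ supp m u x.
Proof.
move=> oU Ux u0 /(_ U oU Ux).
have -> : U `&` [set y | u y != 0] = set0.
  by apply/seteqP; split => // y [/= /u0 ->]; rewrite eqxx.
by rewrite measure0 ltxx.
Qed.

Hypothesis cE : closed_form m D E.
Hypothesis cF : compact [set: F].
Hypothesis lE : local_form m D E.
Hypothesis D1 : D (fun=> 1).
Hypothesis E1 : forall v, D v -> E (fun=> 1) v = 0.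
(** A Markov property up to a constant: it keeps truncations in [D] with bounded energy, which lower
    semicontinuity requires. Locality improves the constant to 1. *)
Variable C0 : R.
Hypothesis truncE : forall u, D u -> D (trunc01 u) /\ E (trunc01 u) (trunc01 u) <= C0 * E u u.

Lemma dom_cst (c : R) : D (fun=> c).
Proof.
by have := dom_lin sE c D1 (dom0 sE); congr D; apply/funext => x; rewrite mulr1 addr0.
Qed.

Lemma form_cst (c : R) v : D v -> E (fun=> c) v = 0.
Proof.
move=> Dv; have -> : (fun=> c) = (fun x : F => c * 1 + 0) by apply/funext => x; rewrite mulr1 addr0.
by rewrite (form_linl sE) ?E1 ?form_zero ?mulr0 ?addr0//; exact: (dom0 sE).
Qed.

Lemma form_sub_cst u (c : R) : D u -> D (fun x => u x - c) /\
  E (fun x => u x - c) (fun x => u x - c) = E u u.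
Proof.
move=> Du; have Dc := dom_cst (- c).
have -> : (fun x => u x - c) = (fun x => 1 * u x + (fun=> - c) x).
  by apply/funext => x; rewrite mul1r.
split; first exact: (dom_lin sE).
by rewrite form_sqr_null ?expr1n ?mul1r// ?form_cst// (form_symm sE)// form_cst.
Qed.

Lemma pos_part_dom u : D u -> continuous u ->
  D (pos_part u) /\ E (pos_part u) (pos_part u) <= C0 * E u u.
Proof.
move=> Du cu; have [M [M0 uM]] := continuous_bounded cF cu.
rewrite (pos_part_trunc M0 uM).
have D0 := dom0 sE.
have scale (a : R) v : D v -> D (fun x => a * v x) /\
    E (fun x => a * v x) (fun x => a * v x) = a ^+ 2 * E v v.
  move=> Dv; have -> : (fun x => a * v x) = (fun x => a * v x + 0).
    by apply/funext => x; rewrite addr0.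
  split; first exact: (dom_lin sE).
  by rewrite form_sqr_null// ?(form_symm sE Dv D0) form_zero.
have [Du' eu'] := scale M^-1 u Du; have [Dt et] := truncE Du'.
have [Ds ->] := scale M _ Dt; split=> //.
apply: (@le_trans _ _ (M ^+ 2 * (C0 * (M^-1 ^+ 2 * E u u)))).
  by rewrite -eu' ler_wpM2l ?sqr_ge0.
by rewrite le_eqVlt; apply/orP; left; apply/eqP; field; rewrite gt_eqF.
Qed.

(* For [eta > 0] the supports of [1 - trunc01 f] and [(f - 1 - eta)^+] are
   disjoint and [E 1 _ = 0]; then let [eta] tend to [0] by [dirichlet_lsc]. *)
Lemma form_trunc_pos f : D f -> continuous f ->
  E (trunc01 f) (pos_part (fun x => f x - 1)) = 0.
Proof.
move=> Df cf; have [Dt _] := truncE Df.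
have cfc (c : R) : continuous (fun x => f x - c).
  by move=> x; apply: cvgB; [exact: cf|exact: cvg_cst].
have dom_g (c : R) := pos_part_dom (proj1 (form_sub_cst c Df)) (cfc c).
have [Dg _] := dom_g 1.
have [|_ -> _ //] := @dirichlet_lsc _ _ _ _ _ mfin sE cE (trunc01 f)
  (pos_part (fun x => f x - 1)) (C0 * E f f) Dt (dom_L2 sE Dg).
move=> eps e0; pose mF := fine (m [set: Borel F]).
have mF0 : 0 <= mF by exact: fine_ge0.
(* The squared L^2 distance is at most [eta ^+ 2 * mF], hence at most [eta * (mF + 1)] since
   [eta <= 1]. *)
pose eta := Num.min 1 (eps / (mF + 1)).
have eta0 : 0 < eta by rewrite lt_min ltr01 divr_gt0//; lra.
have [Dgn egn] := dom_g (1 + eta); exists (pos_part (fun x => f x - (1 + eta))); split=> //.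
- have D1t : D (fun x => 1 - trunc01 f x) := dom_sub sE D1 Dt.
  have tE : trunc01 f = (fun x => (-1) * (1 - trunc01 f x) + 1).
    by apply/funext => x; ring.
  rewrite tE (form_linl sE)// E1// addr0; apply/eqP; rewrite mulf_eq0; apply/orP; right.
  apply/eqP/lE => //; [exact: supp_compact|exact: supp_compact|].
  apply/seteqP; split => // x [/= s1 s2].
  (* The gap [eta] makes the open sets [f > 1] and [f < 1 + eta] cover [F]; one of the two functions
     vanishes on each. *)
  have [fx|fx] := ltP 1 (f x).
    apply: (@supp_open0 (fun x => 1 - trunc01 f x) (f @^-1` [set r | 1 < r]) x) => //.
      by move: cf => /continuousP; apply; exact: open_gt.
    move=> y /= fy; rewrite /trunc01 max_r ?min_r ?subrr// ?(ltW fy)//.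
    by rewrite (le_trans ler01)// ltW.
  apply: (@supp_open0 (pos_part (fun x => f x - (1 + eta))) (f @^-1` [set r | r < 1 + eta]) x) => //.
  - by move: cf => /continuousP; apply; exact: open_lt.
  - by rewrite /=; lra.
  - by move=> y /= fy; rewrite /pos_part max_l//; lra.
- apply: le_trans (nrm2_bounded mfin (c := eta) _ _) _.
  + by apply: L2_sub => //; exact: (dom_L2 sE).
  + move=> x; rewrite (ger0_norm (ltW eta0)) /pos_part !maxEle.
    by case: (leP 0 (f x - (1 + eta))) => ?; case: (leP 0 (f x - 1)) => ?;
      rewrite ler_norml; apply/andP; split; lra.
  + rewrite -/mF; have h1 : eta <= 1 by rewrite ge_min lexx.
    have h2 : eta * (mF + 1) <= eps by rewrite -ler_pdivlMr ?ge_min ?lexx ?orbT//; lra.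
    apply: le_trans h2; apply: (@le_trans _ _ (eta * mF)).
      by rewrite ler_wpM2r// expr2 ler_piMr// ltW.
    by rewrite ler_wpM2l ?ltW//; lra.
- by have [_ <-] := form_sub_cst (1 + eta) Df.
Qed.

(* [f - trunc01 f = (f - 1)^+ - (- f)^+] is [E]-orthogonal to [trunc01 f]. *)
Lemma trunc_markov_continuous f : D f -> continuous f ->
  E (trunc01 f) (trunc01 f) <= E f f.
Proof.
move=> Df cf; have [Dt _] := truncE Df.
have c1f : continuous (fun x => 1 - f x).
  by move=> x; apply: cvgB; [exact: cvg_cst|exact: cf].
have D1f : D (fun x => 1 - f x) := dom_sub sE D1 Df.
have cf1 : continuous (fun x => f x - 1).
  by move=> x; apply: cvgB; [exact: cf|exact: cvg_cst].
have [Dp _] := pos_part_dom (proj1 (form_sub_cst 1 Df)) cf1.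
have c2 : continuous (fun x => 1 - f x - 1).
  by move=> x; apply: cvgB; [exact: c1f|exact: cvg_cst].
have [Dn _] := pos_part_dom (proj1 (form_sub_cst 1 D1f)) c2.
(* The reflection [1 - f] exchanges the levels 0 and 1, so the same lemma handles [(- f)^+]. *)
have h1 := form_trunc_pos Df cf; have h2 := form_trunc_pos D1f c1f.
set p := pos_part (fun x => f x - 1) in h1 Dp.
set n := pos_part (fun x => 1 - f x - 1) in h2 Dn.
have tE : trunc01 (fun x => 1 - f x) = (fun x => (-1) * trunc01 f x + 1).
  apply/funext => x; have [f0|f0] := leP (f x) 0.
    by rewrite trunc01_hi ?trunc01_lo//; lra.
  have [f1|f1] := leP (f x) 1; first by rewrite !trunc01_id ?(ltW f0) ?f1//; lra.
  by rewrite trunc01_lo ?trunc01_hi ?(ltW f1)//; lra.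
have h3 : E (trunc01 f) n = 0.
  by move: h2; rewrite tE (form_linl sE)// E1//; lra.
have fE : f = (fun x => 1 * trunc01 f x + (fun x => (-1) * n x + p x) x).
  apply/funext => x; rewrite /p /n /pos_part; have [f0|f0] := leP (f x) 0.
    by rewrite trunc01_lo// max_r ?max_l; lra.
  have [f1|f1] := leP (f x) 1.
    by rewrite trunc01_id ?(ltW f0)// !max_l; lra.
  by rewrite trunc01_hi ?(ltW f1)// max_l ?max_r; lra.
have Dr : D (fun x => (-1) * n x + p x) by exact: (dom_lin sE).
have -> : E f f = E (trunc01 f) (trunc01 f) + E (fun x => (-1) * n x + p x) (fun x => (-1) * n x + p x).
  rewrite {1 2}fE form_sqr//  (form_linr sE)// h1 h3; ring.
by rewrite lerDl (form_nneg sE).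
Qed.

Lemma trunc_markov f : regular m D E -> D f -> E (trunc01 f) (trunc01 f) <= E f f.
Proof.
move=> [reg _] Df; have [Dt _] := truncE Df; apply/ler_addgt0Pr => eta eta0.
have [eps0 [eps00 near_f]] := form_near_le Df eta0.
have [|_ _ //] := @dirichlet_lsc _ _ _ _ _ mfin sE cE (fun=> 0)
  (trunc01 f) (E f f + eta) (dom0 sE) (dom_L2 sE Dt).
move=> eps e0; have [|g [Dg cg fg]] := reg f Df (Num.min eps0 eps).
  by rewrite lt_min eps00.
move: fg; rewrite /Defs.E1 lt_min => /andP[fg1 fg2].
have [Dtg _] := truncE Dg; have Dfg := dom_sub sE Df Dg.
exists (trunc01 g); split=> //; first exact: form_zero.
- apply: (@le_trans _ _ (nrm2 m (fun x => f x - g x))).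
    apply: nrm2_le; [exact/(dom_L2 sE)/(dom_sub sE)|exact: (dom_L2 sE)|].
    by move=> x; rewrite [leRHS]distrC; exact: trunc01_dist.
  by have := form_nneg sE Dfg; lra.
- apply: le_trans (trunc_markov_continuous Dg cg) _; apply: near_f => //.
  by have := ip_ge0 m (fun x => f x - g x); rewrite /nrm2 in fg1; lra.
Qed.

End FormAlgebra.

(** * Conservativeness and irreducibility *)

Section HeatFlowConsequences.
Variables (R : realType) (F : pseudoPMetricType R).
Variable m : {measure set (Borel F) -> \bar R}.
Variables (D : set (F -> R)) (E : (F -> R) -> (F -> R) -> R).
Hypothesis mfin : (m [set: Borel F] < +oo)%E.
Hypothesis sE : Defs.symmetric_form m D E.
Hypothesis cE : closed_form m D E.

(** A function of [D] uniformly within 1/2 of 1 is at least 1 once doubled, so its truncation is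
    exactly 1. *)
Lemma constant_dom : markovian D E -> regular m D E -> D (fun=> 1).
Proof.
move=> mE [_ reg].
have h2 : 0 < 2^-1 :> R by rewrite invr_gt0.
have c1 : continuous ((fun=> 1) : F -> R) by move=> x; exact: cvg_cst.
have [v [Dv _ v1]] := reg (fun=> 1) c1 _ h2.
have D2 : D (fun x => 2 * v x + 0) := dom_lin sE 2 Dv (dom0 sE).
have [Dt _] := mE _ D2; move: Dt; congr D; apply/funext => x.
have := v1 x; rewrite ltr_norml => /andP[v2 _].
have v3 : 1 <= 2 * v x + 0 by lra.
by rewrite max_r ?min_r// (le_trans ler01).
Qed.

(** The derivative of [ip m (u s) v] at time 1 is 0 by constancy and [- E g v] by the heat
    equation. *)
Lemma stationary_heat_solution f g u : L2 m g -> heat_solution m D E f u ->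
  (forall t : R, 0 < t -> aeq m (u t) g) -> D g /\ forall v, D v -> E g v = 0.
Proof.
move=> Lg [_ _ _ uD uder] ug; have u1 := ug 1 ltr01; have Du := uD 1 ltr01.
have Dg : D g := dom_aeq sE Du Lg u1; split=> // v Dv.
rewrite -(form_aeq sE Du Dg Dv Dv u1 (ae_eq_refl _ _ _)).
apply/eqP; rewrite -oppr_eq0; apply/eqP.
have d1 := uder v Dv 1 ltr01.
have d2 : is_derive (1 : R) (1 : R) (fun s : R => ip m (u s) v) 0.
  apply: (@near_eq_is_derive _ _ _ (cst (ip m g v))).
  near=> s; have s0 : 0 < s by near: s; exact: lt_nbhsr.
  have Lv := dom_L2 sE Dv; have Lu := dom_L2 sE (uD s s0).
  exact: (aeq_ip Lg Lu Lv Lv (aeq_sym (ug s s0)) (ae_eq_refl _ _ _)).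
by rewrite -(@derive_val _ _ _ _ _ _ _ d1) (@derive_val _ _ _ _ _ _ _ d2).
Unshelve. all: by end_near. Qed.

Lemma conservative_constant v : conservative m D E -> D v -> E (fun=> 1) v = 0.
Proof.
move=> conE Dv; have L1 := L2_cst mfin (1 : R).
have [u uP] := heat_solution_exists mfin sE cE L1.
by have [_] := stationary_heat_solution L1 uP (conE _ uP); exact.
Qed.

Lemma constant_heat_solution g : D g -> (forall v, D v -> E g v = 0) ->
  heat_solution m D E g (fun=> g).
Proof.
move=> Dg g0; have Lg := dom_L2 sE Dg; split=> //.
- exact: ae_eq_refl.
- move=> t _ eps e0; exists 1; split=> // s _ _.
  by rewrite aeq_nrm2_sub//; exact: ae_eq_refl.
- by move=> v Dv t _; rewrite g0// oppr0; exact: is_derive_cst.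
Qed.

Lemma constant_conservative : D (fun=> 1) -> (forall v, D v -> E (fun=> 1) v = 0) ->
  conservative m D E.
Proof.
move=> D1 E1 u uP t t0; have L1 := dom_L2 sE D1.
have r1 : aeq m (fun=> 1) (fun=> 1) := ae_eq_refl _ _ _.
exact: (heat_solution_unique mfin sE cE r1 L1 L1 uP (constant_heat_solution D1 E1) t0).
Qed.

Lemma invariant_indic (A : set F) : D (fun=> 1) -> (forall v, D v -> E (fun=> 1) v = 0) ->
  invariant_set m D E A -> D (\1_A : F -> R) /\ forall v, D v -> E (\1_A) v = 0.
Proof.
move=> D1 E1 [mA inv]; have L1 := dom_L2 sE D1.
have LA : L2 m (fun x => \1_A x * 1) := L2_mul_indic mA L1.
have [u uP] := heat_solution_exists mfin sE cE LA.
have LA' : L2 m (\1_A : F -> R).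
  by move: LA; congr L2; apply/funext => x; rewrite mulr1.
apply: (stationary_heat_solution LA' uP) => t t0.
have := inv _ L1 _ _ uP (constant_heat_solution D1 E1) t t0.
by congr (aeq m _); apply/funext => x; rewrite mulr1.
Qed.

(** A projection that contracts the energy is orthogonal: [E a a <= E (t c + a) (t c + a)] for all
    [t] forces [E c a = 0]. So [P] is symmetric for [E] and for [ip], and maps the heat solution
    from [f] to one from [P f]; uniqueness concludes. *)
Lemma indic_contraction_invariant (A : set F) : measurable (A : set (Borel F)) ->
  (forall w, D w -> D (fun x => \1_A x * w x) /\
     E (fun x => \1_A x * w x) (fun x => \1_A x * w x) <= E w w) ->
  invariant_set m D E A.
Proof.
move=> mA contr; pose P (w : F -> R) x := \1_A x * w x : R.
have DP w : D w -> D (P w) by move=> /contr[].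
have PP w : P (P w) = P w.
  by apply/funext => x; rewrite /P indicE; case: (x \in A); rewrite ?mul1r ?mul0r.
have orth u v : D u -> D v -> E (P u) (fun x => v x - P v x) = 0.
  move=> Du Dv; pose a := P u; pose c x := v x - P v x.
  have Da := DP _ Du; have Dc : D c := dom_sub sE Dv (DP _ Dv).
  have h (t : R) : 0 <= t ^+ 2 * E c c + 2 * t * E c a.
    have Dw : D (fun x => t * c x + a x) by exact: (dom_lin sE).
    have [_] := contr _ Dw.
    have -> : (fun x => \1_A x * (t * c x + a x)) = a.
      apply/funext => x; rewrite /c /a /P indicE.
      by case: (x \in A); rewrite ?mul1r ?mul0r// subrr mulr0 add0r.
    by rewrite (form_sqr sE)//; lra.
  rewrite -[LHS]/(E a c) (form_symm sE)//; have := form_nneg sE Dc.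
  rewrite le_eqVlt => /predU1P[c0|c0]; first by apply: (form_null sE).
  have := h (- E c a / E c c).
  have -> : (- E c a / E c c) ^+ 2 * E c c + 2 * (- E c a / E c c) * E c a
     = - (E c a ^+ 2 / E c c) by field; rewrite gt_eqF.
  rewrite oppr_ge0 pmulr_lle0 ?invr_gt0// => le0.
  by apply/eqP; rewrite -sqrf_eq0 eq_le le0 sqr_ge0.
have symP u v : D u -> D v -> E (P u) v = E u (P v).
  have split_r a b : D a -> D b -> E (P a) b = E (P a) (P b).
    move=> Da Db; have bE : b = (fun x => 1 * (b x - P b x) + P b x).
      by apply/funext => x; rewrite mul1r subrK.
    have Dd := dom_sub sE Db (DP _ Db).
    by rewrite {1}bE (form_linr sE) ?orth ?mulr0 ?add0r//; exact: DP.
  move=> Du Dv; rewrite split_r// [RHS](form_symm sE)//; last exact: DP.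
  by rewrite [RHS]split_r// (form_symm sE)//; exact: DP.
split=> // f Lf u w uP wP t t0.
have LPf : L2 m (P f) := L2_mul_indic mA Lf.
have rPf : aeq m (P f) (P f) := ae_eq_refl _ _ _.
suff sol : heat_solution m D E (P f) (fun s => P (w s)).
  exact: (heat_solution_unique mfin sE cE rPf LPf LPf uP sol t0).
have [w0 wL wc wD wder] := wP.
have LP (g : F -> R) : L2 m g -> L2 m (P g) by move=> ?; exact: L2_mul_indic.
split.
- by move: w0; apply: filterS => x h /h; rewrite /P => ->.
- by move=> s s0; apply/LP/wL.
- move=> s s0 eps e0; have [eta [eta0 etaP]] := wc s s0 eps e0.
  exists eta; split=> // r r0 rs; apply: le_lt_trans (etaP r r0 rs).
  have Lr := wL r r0; have Ls := wL s s0.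
  apply: nrm2_le; [by apply: L2_sub; exact: LP|exact: L2_sub|].
  by move=> x; rewrite /P indicE; case: (x \in A); rewrite ?mul1r// !mul0r subrr normr0.
- by move=> s s0; apply/DP/wD.
- move=> v Dv s s0; have h := symP _ _ (wD s s0) Dv.
  have eq : (fun r : R => ip m (w r) (P v)) = (fun r => ip m (P (w r)) v).
    by apply/funext => r; rewrite /ip; congr fine; apply: eq_integral => x _; rewrite /P; congr (_%:E); ring.
  by have := wder _ (DP _ Dv) s s0; rewrite eq -h.
Qed.

(* If [0 <= w <= 1] then [\1_A w] is the truncation of [w + \1_A - 1], which has
   the same energy as [w]. *)
Lemma null_indic_contraction (A : set F) : compact [set: F] -> markovian D E -> regular m D E ->
  D (fun=> 1) -> (forall v, D v -> E (fun=> 1) v = 0) ->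
  measurable (A : set (Borel F)) ->
  D (\1_A : F -> R) -> (forall v, D v -> E (\1_A) v = 0) ->
  forall w, D w -> D (fun x => \1_A x * w x) /\
     E (fun x => \1_A x * w x) (fun x => \1_A x * w x) <= E w w.
Proof.
move=> cF mE [reg _] D1 E1 mA DA EA0.
have add_null (a b c : R) u : D u ->
   D (fun x => a * u x + (b * \1_A x + c)) /\
   E (fun x => a * u x + (b * \1_A x + c)) (fun x => a * u x + (b * \1_A x + c)) = a ^+ 2 * E u u.
  move=> Du; have Dc : D (fun=> c) := dom_cst sE D1 c.
  have Dn : D (fun x => b * \1_A x + c) by exact: (dom_lin sE).
  have En v : D v -> E (fun x => b * \1_A x + c) v = 0.
    by move=> Dv; rewrite (form_linl sE)// EA0// mulr0 add0r (form_cst sE).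
  split; first exact: (dom_lin sE).
  by rewrite (form_sqr_null sE)//; [rewrite (form_symm sE)// En|exact: En].
have cont w : D w -> continuous w -> D (fun x => \1_A x * w x) /\
     E (fun x => \1_A x * w x) (fun x => \1_A x * w x) <= E w w.
  move=> Dw cw; have [M [M0 wM]] := continuous_bounded cF cw.
  have M2 : 0 < 2 * M by lra.
  (* [w] is first rescaled to [(w / M + 1) / 2], with values in [[0, 1]]; undoing this after
     truncation subtracts [M * \1_A]. The added terms carry no energy. *)
  pose z x := (2 * M)^-1 * w x + (1 * \1_A x + (2^-1 - 1)) : R.
  have [Dz Ez] := add_null (2 * M)^-1 1 (2^-1 - 1) w Dw.
  have [Dt Et] := mE _ Dz.
  have [Ds Es] := add_null (2 * M) (- M) 0 _ Dt.
  have eq : (fun x => \1_A x * w x) =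
      (fun x => 2 * M * Num.min (Num.max 0 (z x)) 1 + (- M * \1_A x + 0)).
    apply/funext => x; have := wM x; rewrite ler_norml => /andP[w1 w2].
    have e1 : (2 * M)^-1 * w x = (w x / M) / 2 by field; rewrite gt_eqF.
    have e2 : w x / M <= 1 by rewrite ler_pdivrMr// mul1r.
    have e3 : -1 <= w x / M by rewrite ler_pdivlMr// mulN1r.
    rewrite /z e1 indicE; case: (x \in A) => /=.
      rewrite max_r ?min_l; [|lra|lra]; field; by rewrite gt_eqF.
    rewrite max_l ?min_l; [lra|lra|lra].
  rewrite eq; split=> //; rewrite Es.
  apply: (@le_trans _ _ ((2 * M) ^+ 2 * ((2 * M)^-1 ^+ 2 * E w w))).
    by rewrite ler_wpM2l ?sqr_ge0// -Ez.
  by rewrite le_eqVlt; apply/orP; left; apply/eqP; field; rewrite gt_eqF.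
move=> w Dw; have Lw := L2_mul_indic mA (dom_L2 sE Dw).
have lsc (eta : R) : 0 < eta -> D (fun x => \1_A x * w x) /\
     E (fun x => \1_A x * w x) (fun x => \1_A x * w x) <= E w w + eta.
  move=> eta0; have [eps0 [eps00 near_w]] := form_near_le sE Dw eta0.
  have [|? _ ?//] := @dirichlet_lsc _ _ _ _ _ mfin sE cE (fun=> 0)
    (fun x => \1_A x * w x) (E w w + eta) (dom0 sE) Lw.
  move=> eps e0; have [|g [Dg cg wg]] := reg w Dw (Num.min eps0 eps).
    by rewrite lt_min eps00.
  move: wg; rewrite /Defs.E1 lt_min => /andP[wg1 wg2].
  have Dwg := dom_sub sE Dw Dg; have [Dc Ec] := cont g Dg cg.
  exists (fun x => \1_A x * g x); split=> //; first exact: (form_zero sE).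
  - apply: (@le_trans _ _ (nrm2 m (fun x => w x - g x))).
      apply: nrm2_le; [apply: L2_sub => //; exact: (dom_L2 sE)|exact: (dom_L2 sE)|].
      move=> x; rewrite indicE distrC; case: (x \in A); rewrite ?mul1r// !mul0r subrr normr0//.
    by have := form_nneg sE Dwg; lra.
  - apply: le_trans Ec _; apply: near_w => //.
    by have := ip_ge0 m (fun x => w x - g x); rewrite /nrm2 in wg1; lra.
split; first by have [] := lsc 1 ltr01.
by apply/ler_addgt0Pr => eta /lsc[].
Qed.

End HeatFlowConsequences.

(** * Comparison of [(1 + delta) * EB - EA] with [EB] *)

Section Perturbation.
Variables (R : realType) (F : pseudoPMetricType R).
Variable m : {measure set (Borel F) -> \bar R}.
Variables (D : set (F -> R)) (EA EB : (F -> R) -> (F -> R) -> R) (delta : R).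
Hypotheses (sA : Defs.symmetric_form m D EA) (sB : Defs.symmetric_form m D EB).
Hypothesis AB : forall u, D u -> EA u u <= EB u u.
Hypothesis delta0 : 0 < delta.

Let E u v := (1 + delta) * EB u v - EA u v.

Lemma perturbation_ge u : D u -> delta * EB u u <= E u u.
Proof. move=> /AB; rewrite /E; lra. Qed.

Lemma perturbation_le u : D u -> E u u <= (1 + delta) * EB u u.
Proof. by move=> Du; have := form_nneg sA Du; rewrite /E; lra. Qed.

Lemma perturbation_symmetric : Defs.symmetric_form m D E.
Proof.
have [[h1 h2 h3 h4 h5] _] := sA; split; split=> //.
- move=> u u' v v' Du Du' Dv Dv' uu vv; rewrite /E.
  by rewrite (form_aeq sA Du Du' Dv Dv' uu vv) (form_aeq sB Du Du' Dv Dv' uu vv).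
- by move=> u v Du Dv; rewrite /E (form_symm sA Du Dv) (form_symm sB Du Dv).
- move=> c u v w Du Dv Dw; rewrite /E (form_linl sA c Du Dv Dw) (form_linl sB c Du Dv Dw); ring.
- move=> u Du; apply: le_trans (perturbation_ge Du).
  by rewrite mulr_ge0 ?(form_nneg sB)// ltW.
Qed.

Lemma perturbation_E1_ge u : D u -> E1 m EB u <= (1 + delta^-1) * E1 m E u.
Proof.
move=> Du; have := perturbation_ge Du; rewrite -ler_pdivlMl// => h.
have d0 : 0 < delta^-1 by rewrite invr_gt0.
have q0 := ip_ge0 m u; have e0 := form_nneg perturbation_symmetric Du.
have := mulr_ge0 (ltW d0) q0; rewrite /E1 /nrm2; lra.
Qed.

Lemma perturbation_E1_le u : D u -> E1 m E u <= (1 + delta) * E1 m EB u.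
Proof.
move=> Du; have := perturbation_le Du; have := mulr_ge0 (ltW delta0) (ip_ge0 m u).
rewrite /E1 /nrm2; lra.
Qed.

Lemma perturbation_closed : closed_form m D EB -> closed_form m D E.
Proof.
move=> cB u Du uC.
have d1 : 0 < 1 + delta^-1 by rewrite addr_gt0// invr_gt0.
have d2 : 0 < 1 + delta by rewrite addr_gt0.
have [|w [Dw wP]] := cB u Du.
  move=> eps e0; have [N NP] := uC _ (divr_gt0 e0 d1); exists N => n k nN kN.
  apply: le_lt_trans (perturbation_E1_ge (dom_sub sB (Du n) (Du k))) _.
  by rewrite mulrC -ltr_pdivlMr//; exact: NP.
exists w; split=> // eps e0; have [N NP] := wP _ (divr_gt0 e0 d2); exists N => n nN.
apply: le_lt_trans (perturbation_E1_le (dom_sub sB (Du n) Dw)) _.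
by rewrite mulrC -ltr_pdivlMr//; exact: NP.
Qed.

Lemma perturbation_regular : regular m D EB -> regular m D E.
Proof.
move=> [r1 r2]; split=> // u Du eps e0; have d2 : 0 < 1 + delta by rewrite addr_gt0.
have [v [Dv cv uv]] := r1 u Du _ (divr_gt0 e0 d2); exists v; split=> //.
apply: le_lt_trans (perturbation_E1_le (dom_sub sB Du Dv)) _.
by rewrite mulrC -ltr_pdivlMr.
Qed.

Lemma perturbation_local : local_form m D EA -> local_form m D EB -> local_form m D E.
Proof.
by move=> lA lB u v Du Dv cu cv uv; rewrite /E lA// lB// mulr0 subrr.
Qed.

(** Truncation decreases [EB]; passing from [E] to [EB] costs [1 / delta] and returning costs
    [1 + delta]. *)
Lemma perturbation_trunc u : markovian D EB -> D u -> D (trunc01 u) /\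
  E (trunc01 u) (trunc01 u) <= (1 + delta) / delta * E u u.
Proof.
move=> mB Du; have [Dt Et] := mB u Du; split=> //.
apply: le_trans (perturbation_le Dt) _; rewrite -mulrA ler_wpM2l//; first by rewrite addr_ge0// ltW.
by apply: le_trans Et _; rewrite ler_pdivlMl//; exact: perturbation_ge.
Qed.

End Perturbation.

Theorem theorem2p1 (R : realType) (F : pseudoPMetricType R)
  (m : {measure set (Borel F) -> \bar R})
  (D : set (F -> R)) (EA EB : (F -> R) -> (F -> R) -> R) (delta : R) :
  hausdorff_space F -> compact [set: F] -> (m [set: Borel F] < +oo)%E ->
  [/\ dirichlet_form m D EA, local_form m D EA, regular m D EA,
      conservative m D EA & irreducible m D EA] ->
  [/\ dirichlet_form m D EB, local_form m D EB, regular m D EB,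
      conservative m D EB & irreducible m D EB] ->
  (forall u, D u -> EA u u <= EB u u) ->
  0 < delta ->
  let E := fun u v => (1 + delta) * EB u v - EA u v in
  [/\ dirichlet_form m D E, regular m D E, local_form m D E,
      conservative m D E & irreducible m D E].
Proof.
move=> _ cF mfin [[sA cA mA] lA rA conA _] [[sB cB mB] lB rB conB irrB] AB delta0 E.
have sE : Defs.symmetric_form m D E := perturbation_symmetric sA sB AB delta0.
have cE : closed_form m D E := perturbation_closed sA sB AB delta0 cB.
have rE : regular m D E := perturbation_regular sA sB delta0 rB.
have lE : local_form m D E := perturbation_local delta lA lB.
have D1 := constant_dom sB mB rB.
have A1 v := @conservative_constant _ _ _ _ _ mfin sA cA v conA.
have B1 v := @conservative_constant _ _ _ _ _ mfin sB cB v conB.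
have E1 v : D v -> E (fun=> 1) v = 0 by move=> Dv; rewrite /E A1// B1// mulr0 subrr.
have tE u := @perturbation_trunc _ _ _ _ _ _ _ sA AB delta0 u mB.
split=> //.
- split=> // u Du; have [Dt _] := tE u Du; split=> //.
  exact: (trunc_markov mfin sE cE cF lE D1 E1 tE rE Du).
- exact: (constant_conservative mfin sE cE).
- move=> A invA; apply: irrB; have [mesA _] := invA.
  have [DA EA0] := invariant_indic mfin sE cE D1 E1 invA.
  have BAA : EB (\1_A) (\1_A) = 0.
    apply/le_anti; rewrite (form_nneg sB DA) andbT -(pmulr_rle0 _ delta0).
    apply: le_trans (perturbation_ge delta AB DA) _.
    by rewrite le_eqVlt; apply/orP; left; apply/eqP; exact: EA0.
  apply: (indic_contraction_invariant mfin sB cB) => //.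
  apply: (null_indic_contraction mfin sB cB) => // v Dv.
  exact: (form_null sB).
Qed.
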